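(* For every $0<\varepsilon<T$, the rhmsp $X$ is $\|\cdot\|_\alpha$ locally nondeterministic on $[\varepsilon,T]$, i.e.: (L1) $\|X(t)\|_\alpha>0$ for all $t\in[\varepsilon,T]$; (L2) there is $\delta>0$ such that $\|X(t)-X(s)\|_\alpha>0$ for all distinct $s,t\in[\varepsilon,T]$ with $|t-s|<\delta$; (L3) for every $n>1$ there exist $C_n>0$ and $\delta_n>0$ such that for all $\varepsilon\le t_1<t_2<\dots<t_n\le T$ with $t_n-t_1<\delta_n$, $$\inf_{u_1,\dots,u_{n-1}\in\mathbb R}\Big\|X(t_n)-\sum_{k=1}^{n-1}u_kX(t_k)\Big\|_\alpha\ge C_n\|X(t_n)-X(t_{n-1})\|_\alpha.$$
   Context: Fix $\alpha\in(1,2)$. $M$ is an independently scattered rotationally invariant complex S$\alpha$S random measure on $\mathbb R$ with Lebesgue control measure: for every Borel $A$ and $\theta\in\mathbb R$, $e^{i\theta}M(A)\overset{d}{=}M(A)$, $\mathbb E e^{iu\,\mathrm{Re} M(A)}=e^{-\lambda(A)|u|^\alpha}$; values on disjoint Borel subsets of $[0,\infty)$ are independent; $M(-A)=\overline{M(A)}$. For $f$ with $f(-x)=\overline{f(x)}$, $f\in L^\alpha(\mathbb R)$, $\int f\,dM$ is real S$\alpha$S with $\mathbb E\exp(iu\int f dM)=\exp(-|u|^\alpha\|f\|^\alpha_{L^\alpha})$; for such $\xi$, $\|\xi\|_\alpha^\alpha:=-\log\mathbb Ee^{i\xi}$. The Hurst function $H:[0,\infty)\to\mathbb R$ satisfies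 $0<\hat H:=\inf H\le\sup H=:\check H<1$ and $|H(t)-H(s)|\le C|t-s|^\gamma$ for some $C>0$, $\gamma>\check H$ and all $t,s\ge0$. The rhmsp is $X(t)=\int_{\mathbb R}\frac{e^{itx}-1}{|x|^{1/\alpha+H(t)}}M(dx)$, $t\ge0$. *)

(* Defs.v *)
From Stdlib Require Import Reals Lra List Classical ClassicalEpsilon.
Open Scope R_scope.

(* x ^ a for x >= 0 with the convention 0 ^ a = 0 (Rpower 0 a = 1 in Stdlib). *)
Definition rpow (x a : R) : R :=
  if Rlt_dec 0 x then Rpower x a else 0.

(* A real linear combination  sum_j c_j X(t_j)  of values of the rhmsp is
   encoded as a list of pairs (c_j, t_j).  Its kernel is
     g(x) = sum_j c_j (e^{i t_j x} - 1) / |x|^{1/alpha + H(t_j)},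
   so that  sum_j c_j X(t_j) = \int g dM. *)
Definition kern_re (alpha : R) (H : R -> R) (l : list (R * R)) (x : R) : R :=
  fold_right (fun p acc =>
    fst p * (cos (snd p * x) - 1) / Rpower (Rabs x) (/ alpha + H (snd p)) + acc) 0 l.

Definition kern_im (alpha : R) (H : R -> R) (l : list (R * R)) (x : R) : R :=
  fold_right (fun p acc =>
    fst p * sin (snd p * x) / Rpower (Rabs x) (/ alpha + H (snd p)) + acc) 0 l.

Definition kern_abs_pow (alpha : R) (H : R -> R) (l : list (R * R)) (x : R) : R :=
  rpow (sqrt (kern_re alpha H l x ^ 2 + kern_im alpha H l x ^ 2)) alpha.

(* Integrals of a nonnegative function, continuous on R \ {0}, over the compact
   sets [-b,-a] u [a,b] with 0 < a < b.  Their supremum is the Lebesgue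
   integral over R (by monotone convergence). *)
Definition partial_integrals (h : R -> R) (v : R) : Prop :=
  exists a b, 0 < a < b /\
    exists (pr1 : Riemann_integrable h (- b) (- a)) (pr2 : Riemann_integrable h a b),
      v = RiemannInt pr1 + RiemannInt pr2.

Definition sup_or0 (E : R -> Prop) : R :=
  match excluded_middle_informative (bound E /\ exists x, E x) with
  | left h => proj1_sig (completeness E (proj1 h) (proj2 h))
  | right _ => 0
  end.

Definition Lalpha_pow (alpha : R) (H : R -> R) (l : list (R * R)) : R :=
  sup_or0 (partial_integrals (kern_abs_pow alpha H l)).

(* || sum_j c_j X(t_j) ||_alpha = (-log E e^{i xi})^{1/alpha} = ||g||_{L^alpha}. *)
Definition snorm (alpha : R) (H : R -> R) (l : list (R * R)) : R :=
  rpow (Lalpha_pow alpha H l) (/ alpha).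

Definition hurst_hyp (H : R -> R) : Prop :=
  exists hlo hhi, 0 < hlo /\ hhi < 1 /\
    (forall t, 0 <= t -> hlo <= H t <= hhi) /\
    exists C gamma, 0 < C /\ hhi < gamma /\
      forall t s, 0 <= t -> 0 <= s -> Rabs (H t - H s) <= C * rpow (Rabs (t - s)) gamma.

Definition pred_comb (n : nat) (t u : nat -> R) : list (R * R) :=
  (1, t (n - 1)%nat) :: map (fun k => (- u k, t k)) (seq 0 (n - 1)).

(* Main.v *)
Require Import Defs.
From Stdlib Require Import Reals Lra Lia List FunctionalExtensionality.
From Coquelicot Require Import Coquelicot.
Open Scope R_scope.

(* Let d = t_n - t_{n-1}.  A direct estimate of the kernel gives
   ||X(t_n) - X(t_{n-1})||^alpha <= K d^(alpha H(t_n)); here the Hoelder exponent of H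
   exceeds sup H, so varying H costs no more than varying t.  Conversely, restrict the
   norm of X(t_n) - sum u_k X(t_k) to 1/d <= x <= 2/d, put x = y/d and multiply the
   kernel by e^{-i t_n x} |x|^(1/alpha + H(t_n)).  It becomes
   1 + sum_j v_j e^{-i om_j y} y^(b_j) on [1,2], with 2n - 1 frequencies |om_j| >= 1
   (namely (t_n - t_k)/d and t_n/d), exponents |b_j| <= 1 and arbitrary v_j.
   Its L^1 norm is bounded below by a constant depending only on n: there is a test
   function psi with |psi| <= C(n), orthogonal to all e^{-i om_j y} y^(b_j), whose
   integral is a nonzero constant.  To construct psi, apply to a derivative of a bump
   the operators chi |-> y chi + (i/om)((y chi)' + be chi).  Such an operator expresses
   the moments at (om', b) by those at (om', b) and (om', b + 1); for om' = om only the
   one at (om, b) is involved, with a factor b - be, and for om' = 0 the moment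
   at b + 1 has coefficient 1.  All om_j enter through 1/om_j, whence uniform bounds. *)

(** * Moments against y^b e^{-i om y} *)

(** The real part of int_1^2 y^b e^{-i om y} (u + i w) dy. The imaginary part is
    [moment om b w (fun y => - u y)], so this one real functional covers both. *)
Definition moment (om b : R) (u w : R -> R) : R :=
  RInt (fun y => Rpower y b * (cos (om * y) * u y + sin (om * y) * w y)) 1 2.

Lemma cont_of_derive (u u1 : R -> R) :
  (forall y, is_derive u y (u1 y)) -> forall y, continuous u y.
Proof.
  intros Hu y. apply @ex_derive_continuous. exists (u1 y). apply Hu.
Qed.

Lemma continuous_Rpower (b y : R) : 0 < y -> continuous (fun z => Rpower z b) y.
Proof.
  intros Hy. apply @ex_derive_continuous. unfold Rpower. auto_derive. exact Hy.
Qed.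

Lemma continuous_Rmult (f g : R -> R) (x : R) :
  continuous f x -> continuous g x -> continuous (fun y => f y * g y) x.
Proof. intros Hf Hg. exact (@continuous_mult R_UniformSpace R_AbsRing f g x Hf Hg). Qed.

Lemma continuous_Rplus (f g : R -> R) (x : R) :
  continuous f x -> continuous g x -> continuous (fun y => f y + g y) x.
Proof. intros Hf Hg. exact (@continuous_plus R_UniformSpace R_AbsRing R_NormedModule f g x Hf Hg). Qed.

Lemma continuous_Rminus (f g : R -> R) (x : R) :
  continuous f x -> continuous g x -> continuous (fun y => f y - g y) x.
Proof. intros Hf Hg. exact (@continuous_minus R_UniformSpace R_AbsRing R_NormedModule f g x Hf Hg). Qed.

Lemma moment_cont (om b : R) (u w : R -> R) (y : R) :
  0 < y -> continuous u y -> continuous w y ->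
  continuous (fun y => Rpower y b * (cos (om * y) * u y + sin (om * y) * w y)) y.
Proof.
  intros Hy Hu Hw.
  apply continuous_Rmult; [now apply continuous_Rpower|].
  apply (continuous_plus (fun z => cos (om * z) * u z));
    apply continuous_Rmult; try assumption;
    apply @ex_derive_continuous; auto_derive; trivial.
Qed.

Lemma moment_correct (om b : R) (u w : R -> R) :
  (forall y, continuous u y) -> (forall y, continuous w y) ->
  is_RInt (fun y => Rpower y b * (cos (om * y) * u y + sin (om * y) * w y)) 1 2
    (moment om b u w).
Proof.
  intros Hu Hw. apply (@RInt_correct R_CompleteNormedModule).
  apply (@ex_RInt_continuous R_CompleteNormedModule). intros z Hz.
  rewrite Rmin_left, Rmax_right in Hz by lra.
  apply moment_cont; auto; lra.
Qed.

Lemma moment_ext (om b : R) (u w u' w' : R -> R) :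
  (forall y, u y = u' y) -> (forall y, w y = w' y) ->
  moment om b u w = moment om b u' w'.
Proof.
  intros Hu Hw. apply RInt_ext. intros y _. now rewrite Hu, Hw.
Qed.

Lemma moment_opp (om b : R) (u w : R -> R) :
  (forall y, continuous u y) -> (forall y, continuous w y) ->
  moment om b (fun y => - u y) (fun y => - w y) = - moment om b u w.
Proof.
  intros Hu Hw. apply is_RInt_unique.
  apply (is_RInt_ext (fun y => opp
    (Rpower y b * (cos (om * y) * u y + sin (om * y) * w y)))).
  - intros y _. unfold opp; simpl. ring.
  - apply @is_RInt_opp. now apply moment_correct.
Qed.

(* With chi = u + i w and m(om, b, chi) = int_1^2 y^b e^{-i om y} chi, integration by
   parts gives, for chi' = y chi + i k ((y chi)' + be chi),
   m(om, b, chi') = (1 - k om) m(om, b + 1, chi) - i k (b - be) m(om, b, chi).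
   This is its real part; the imaginary part is the same identity for -i chi = w - i u. *)
Lemma moment_step (om b k be : R) (u w u1 w1 : R -> R) :
  (forall y, is_derive u y (u1 y)) -> (forall y, is_derive w y (w1 y)) ->
  (forall y, continuous u1 y) -> (forall y, continuous w1 y) ->
  u 1 = 0 -> u 2 = 0 -> w 1 = 0 -> w 2 = 0 ->
  moment om b (fun y => y * u y - k * (y * w1 y + (1 + be) * w y))
              (fun y => y * w y + k * (y * u1 y + (1 + be) * u y))
  = (1 - k * om) * moment om (b + 1) u w
    + k * (b - be) * moment om b w (fun y => - u y).
Proof.
  intros Hu Hw Cu1 Cw1 Hu1 Hu2 Hw1 Hw2.
  assert (Cu := cont_of_derive _ _ Hu). assert (Cw := cont_of_derive _ _ Hw).
  (* Minus the imaginary part of y^(b+1) e^{-i om y} chi. It vanishes at 1 and 2, so its derivative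
     integrates to 0. *)
  set (F := fun y => Rpower y b * y * (sin (om * y) * u y - cos (om * y) * w y)).
  set (F' := fun y => Rpower y b * ((b + 1) * (sin (om * y) * u y - cos (om * y) * w y)
      + y * om * (sin (om * y) * w y + cos (om * y) * u y)
      + y * (sin (om * y) * u1 y - cos (om * y) * w1 y))).
  assert (HF : is_RInt F' 1 2 (minus (F 2) (F 1))).
  { apply (is_RInt_derive F F').
    - intros y Hy. rewrite Rmin_left, Rmax_right in Hy by lra.
      assert (Eu : Derive (fun z : R => u z) y = u1 y) by apply is_derive_unique, Hu.
      assert (Ew : Derive (fun z : R => w z) y = w1 y) by apply is_derive_unique, Hw.
      unfold F, F', Rpower. auto_derive.
      + repeat split; try lra. exists (u1 y); apply Hu. exists (w1 y); apply Hw.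
      + rewrite Eu, Ew.
        field. lra.
    - intros y Hy. rewrite Rmin_left, Rmax_right in Hy by lra.
      unfold F'.
      apply continuous_Rmult; [apply continuous_Rpower; lra|].
      assert (Cs : continuous (fun y => sin (om * y)) y)
        by (apply @ex_derive_continuous; auto_derive; trivial).
      assert (Cc : continuous (fun y => cos (om * y)) y)
        by (apply @ex_derive_continuous; auto_derive; trivial).
      assert (Ci : continuous (fun y : R => y) y) by apply continuous_id.
      assert (Cub := Cu y). assert (Cwb := Cw y). assert (Cu1b := Cu1 y). assert (Cw1b := Cw1 y).
      assert (K : forall c : R, continuous (fun _ : R => c) y) by (intros c; apply continuous_const).
      apply continuous_Rplus; [apply continuous_Rplus|].
      + exact (continuous_Rmult _ _ _ (K _) (continuous_Rminus _ _ _
          (continuous_Rmult _ _ _ Cs Cub) (continuous_Rmult _ _ _ Cc Cwb))).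
      + exact (continuous_Rmult _ _ _ (continuous_Rmult _ _ _ Ci (K om)) (continuous_Rplus _ _ _
          (continuous_Rmult _ _ _ Cs Cwb) (continuous_Rmult _ _ _ Cc Cub))).
      + exact (continuous_Rmult _ _ _ Ci (continuous_Rminus _ _ _
          (continuous_Rmult _ _ _ Cs Cu1b) (continuous_Rmult _ _ _ Cc Cw1b))). }
  replace (minus (F 2) (F 1)) with 0 in HF.
  2:{ unfold F, minus, plus, opp; simpl. rewrite Hu1, Hu2, Hw1, Hw2. ring. }
  apply is_RInt_unique.
  (* The summand [scal k 0] stands for k times the integral of [F']; with it the two integrands
     agree pointwise. *)
  replace ((1 - k * om) * moment om (b + 1) u w + k * (b - be) * moment om b w (fun y => - u y))
    with (plus (plus (scal (1 - k * om) (moment om (b + 1) u w))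
      (scal (k * (b - be)) (moment om b w (fun y => - u y)))) (scal k 0)).
  2:{ unfold plus, scal; simpl; unfold mult; simpl. ring. }
  eapply is_RInt_ext.
  2:{ apply @is_RInt_plus; [apply @is_RInt_plus|]; apply @is_RInt_scal;
      [apply moment_correct; auto | apply moment_correct; auto | apply HF].
      intros y. apply (continuous_opp u). apply Cu. }
  intros y Hy. rewrite Rmin_left, Rmax_right in Hy by lra.
  unfold F', plus, scal; simpl; unfold mult; simpl.
  rewrite (Rpower_plus b 1), Rpower_1 by lra. ring.
Qed.

(** * Test functions with all their derivatives, and the operators on them *)

Definition is_jet (u : nat -> R -> R) : Prop :=
  forall i y, is_derive (u i) y (u (S i) y).

(** A complex test function chi = u + i w. The number [k] counts the derivatives, from order 0 on,
    that vanish at both end points: each operator differentiates once and so consumes one of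
    them. *)
Definition test_pair (k : nat) (K : nat -> R) (u w : nat -> R -> R) : Prop :=
  is_jet u /\ is_jet w /\
  (forall i, (i < k)%nat -> u i 1 = 0 /\ u i 2 = 0 /\ w i 1 = 0 /\ w i 2 = 0) /\
  (forall i y, 1 <= y <= 2 -> Rabs (u i y) <= K i /\ Rabs (w i y) <= K i).

(* The i-th derivative of y u - k ((y w)' + be w), where u and w are given with all
   their derivatives; for i = 0 the term [u (pred 0)] has coefficient 0. *)
Definition op_jet (k be : R) (u w : nat -> R -> R) (i : nat) (y : R) : R :=
  y * u i y + INR i * u (pred i) y - k * (y * w (S i) y + (INR i + 1 + be) * w i y).

(** For p = (k, be) this is chi |-> y chi + i k ((y chi)' + be chi). Its imaginary part y w + k ((y
    u)' + be u) is [op_jet] with u and w exchanged and k negated. *)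
Definition op (p : R * R) (x : (nat -> R -> R) * (nat -> R -> R)) :=
  (op_jet (fst p) (snd p) (fst x) (snd x), op_jet (- fst p) (snd p) (snd x) (fst x)).

(** The operator enters only through [Bm], a bound for |be|, given |k| <= 1; this makes the final
    constant independent of the frequencies. *)
Definition op_bound (Bm : R) (K : nat -> R) (i : nat) : R :=
  2 * K i + INR i * K (pred i) + (2 * K (S i) + (INR i + 1 + Bm) * K i).

Lemma op_jet_is_jet (k be : R) (u w : nat -> R -> R) :
  is_jet u -> is_jet w -> is_jet (op_jet k be u w).
Proof.
  intros Hu Hw i y. unfold op_jet.
  assert (D : forall v j, is_jet v -> ex_derive (fun z : R => v j z) y)
    by (intros v j Hv; exists (v (S j) y); apply Hv).
  auto_derive.
  - split; [now apply D|]. split; [now apply D|]. split; [now apply D|].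
    split; [now apply D|]. trivial.
  - assert (E : forall v j, is_jet v -> Derive (fun z : R => v j z) y = v (S j) y)
      by (intros v j Hv; apply is_derive_unique, Hv).
    assert (E1 := E u i Hu). assert (E2 := E u (pred i) Hu).
    assert (E3 := E w i Hw). assert (E4 := E w (S i) Hw).
    cbv beta in E1, E2, E3, E4. rewrite E1, E2, E3, E4.
    rewrite S_INR. destruct i; simpl (pred _); [simpl (INR 0); ring|].
    ring.
Qed.

Lemma op_jet_bound (k be Bm : R) (K : nat -> R) (u w : nat -> R -> R) (i : nat) (y : R) :
  Rabs k <= 1 -> Rabs be <= Bm -> 1 <= y <= 2 ->
  (forall i, Rabs (u i y) <= K i /\ Rabs (w i y) <= K i) ->
  Rabs (op_jet k be u w i y) <= op_bound Bm K i.
Proof.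
  intros Hk Hbe Hy HK. unfold op_jet, op_bound.
  assert (Hi := pos_INR i).
  assert (M : forall a b A B, Rabs a <= A -> Rabs b <= B -> Rabs (a * b) <= A * B).
  { intros. rewrite Rabs_mult. apply Rmult_le_compat; auto using Rabs_pos. }
  assert (S2 : forall a b A B, Rabs a <= A -> Rabs b <= B -> Rabs (a + b) <= A + B).
  { intros. eapply Rle_trans; [apply Rabs_triang|lra]. }
  assert (Hy2 : Rabs y <= 2) by (rewrite Rabs_pos_eq; lra).
  assert (Hii : Rabs (INR i) <= INR i) by (rewrite Rabs_pos_eq; lra).
  apply S2; [apply S2; apply M; try apply HK; assumption|].
  rewrite Rabs_Ropp. rewrite <- (Rmult_1_l (2 * K (S i) + _)).
  apply M; [assumption|].
  apply S2; apply M; try apply HK; try assumption.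
  apply S2; [rewrite Rabs_pos_eq; lra|assumption].
Qed.

Lemma op_test_pair (k : nat) (K : nat -> R) (Bm : R) p x :
  Rabs (fst p) <= 1 -> Rabs (snd p) <= Bm ->
  test_pair (S k) K (fst x) (snd x) ->
  test_pair k (op_bound Bm K) (fst (op p x)) (snd (op p x)).
Proof.
  intros Hp Hb (Ju & Jw & Hv & HK). destruct x as [u w], p as [ka be]. simpl in *.
  split; [now apply op_jet_is_jet|]. split; [now apply op_jet_is_jet|]. split.
  - intros i Hi. unfold op_jet.
    destruct (Hv i) as (E1 & E2 & E3 & E4); [lia|].
    destruct (Hv (S i)) as (E1' & E2' & E3' & E4'); [lia|].
    destruct (Hv (pred i)) as (E1'' & E2'' & E3'' & E4''); [lia|].
    rewrite E1, E2, E3, E4, E1', E2', E3', E4', E1'', E2'', E3'', E4''.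
    repeat split; ring.
  - intros i y Hy. split; apply op_jet_bound; auto; try rewrite Rabs_Ropp; auto.
    intros j; destruct (HK j y Hy); auto.
Qed.

(** Real and imaginary part of the moment of chi. An operator mixes them through the factor i k, so
    zeros are tracked for both together. *)
Definition momA (om b : R) (x : (nat -> R -> R) * (nat -> R -> R)) :=
  moment om b (fst x 0%nat) (snd x 0%nat).
Definition momB (om b : R) (x : (nat -> R -> R) * (nat -> R -> R)) :=
  moment om b (snd x 0%nat) (fun y => - fst x 0%nat y).

Lemma is_jet_cont (u : nat -> R -> R) i y : is_jet u -> continuous (u i) y.
Proof. intros Hu. apply (cont_of_derive _ _ (Hu i)). Qed.

Lemma mom_op (om b : R) (k : nat) K p x :
  test_pair (S k) K (fst x) (snd x) ->
  momA om b (op p x) = (1 - fst p * om) * momA om (b + 1) x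
                       + fst p * (b - snd p) * momB om b x /\
  momB om b (op p x) = (1 - fst p * om) * momB om (b + 1) x
                       - fst p * (b - snd p) * momA om b x.
Proof.
  intros (Ju & Jw & Hv & HK). destruct x as [u w], p as [ka be].
  unfold momA, momB; simpl in *.
  destruct (Hv 0%nat) as (E1 & E2 & E3 & E4); [lia|].
  split.
  - rewrite <- moment_step with (u1 := u 1%nat) (w1 := w 1%nat);
      auto; try (intros; now apply is_jet_cont).
    apply moment_ext; intros y; unfold op_jet; simpl; ring.
  (* [moment_step] for the pair (w, -u), that is, for -i chi. *)
  - transitivity ((1 - ka * om) * moment om (b + 1) (w 0%nat) (fun y => - u 0%nat y)
      + ka * (b - be) * moment om b (fun y => - u 0%nat y) (fun y => - w 0%nat y)).
    2:{ rewrite moment_opp by (intros; now apply is_jet_cont). ring. }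
    rewrite <- moment_step with (u1 := w 1%nat) (w1 := fun y => - u 1%nat y); auto; try lra.
    + apply moment_ext; intros y; unfold op_jet; simpl; ring.
    + intros y. apply (is_derive_opp (u 0%nat)). apply Ju.
    + intros; now apply is_jet_cont.
    + intros y. apply (continuous_opp (u 1%nat)). now apply is_jet_cont.
Qed.

(** * Composing operators to annihilate prescribed moments *)

Definition chain (cs : list (R * R)) (x : (nat -> R -> R) * (nat -> R -> R)) :=
  fold_left (fun x p => op p x) cs x.

Lemma chain_test_pair (Bm : R) (cs : list (R * R)) : forall k K x,
  (forall p, In p cs -> Rabs (fst p) <= 1 /\ Rabs (snd p) <= Bm) ->
  test_pair (length cs + k) K (fst x) (snd x) ->
  test_pair k (Nat.iter (length cs) (op_bound Bm) K) (fst (chain cs x)) (snd (chain cs x)).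
Proof.
  induction cs as [|p cs IH]; intros k K x Hcs Hx; [exact Hx|].
  simpl length. rewrite Nat.iter_succ_r. simpl chain.
  apply IH; [intros q Hq; apply Hcs; now right|].
  destruct (Hcs p) as [H1 H2]; [now left|].
  now apply op_test_pair.
Qed.

Definition null_at (om b : R) (d : nat) x : Prop :=
  forall j, (j < d)%nat -> momA om (b + INR j) x = 0 /\ momB om (b + INR j) x = 0.

(** The new moment at b + j combines the old ones at b + j and b + j + 1. Hence an arbitrary
    operator preserves a run of consecutive zeros except for its last member. *)
Lemma null_op (om b : R) d k K p x :
  test_pair (S k) K (fst x) (snd x) ->
  null_at om b (S d) x -> null_at om b d (op p x).
Proof.
  intros Hx Hz j Hj.
  destruct (mom_op om (b + INR j) k K p x Hx) as [EA EB].
  destruct (Hz j) as [A0 B0]; [lia|].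
  destruct (Hz (S j)) as [A1 B1]; [lia|].
  rewrite S_INR, <- Rplus_assoc in A1, B1.
  rewrite EA, EB, A0, B0, A1, B1. split; ring.
Qed.

Lemma null_chain (Bm om b : R) cs : forall d k K x,
  (forall p, In p cs -> Rabs (fst p) <= 1 /\ Rabs (snd p) <= Bm) ->
  test_pair (length cs + k) K (fst x) (snd x) ->
  null_at om b (length cs + d) x -> null_at om b d (chain cs x).
Proof.
  induction cs as [|p cs IH]; intros d k K x Hcs Hx Hz; [exact Hz|].
  simpl. destruct (Hcs p) as [H1 H2]; [now left|].
  apply IH with (k := k) (K := op_bound Bm K).
  - intros q Hq; apply Hcs; now right.
  - now apply op_test_pair.
  - eapply null_op; [apply Hx|exact Hz].
Qed.

(** At frequency 0 the raised exponent enters [mom_op] with coefficient 1, and the other term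
    vanishes by [null_at]. Each operator thus lowers the exponent of the first possibly nonzero
    moment by one and keeps its value. *)
Lemma target_chain (Bm : R) cs : forall d k K x,
  (forall p, In p cs -> Rabs (fst p) <= 1 /\ Rabs (snd p) <= Bm) ->
  test_pair (length cs + k) K (fst x) (snd x) ->
  null_at 0 0 (length cs + d) x ->
  momA 0 (INR d) (chain cs x) = momA 0 (INR (length cs + d)) x.
Proof.
  induction cs as [|p cs IH]; intros d k K x Hcs Hx Hz; [reflexivity|].
  simpl chain. destruct (Hcs p) as [H1 H2]; [now left|].
  rewrite IH with (k := k) (K := op_bound Bm K).
  - simpl length in *.
    destruct (mom_op 0 (INR (length cs + d)) _ K p x Hx) as [EA _].
    destruct (Hz (length cs + d)%nat) as [_ B0]; [lia|].
    rewrite Rplus_0_l in B0. rewrite EA, B0.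
    change (S (length cs) + d)%nat with (S (length cs + d)). rewrite S_INR. ring.
  - intros q Hq; apply Hcs; now right.
  - now apply op_test_pair.
  - eapply null_op; [apply Hx|exact Hz].
Qed.

(** With k = 1/om the coefficient 1 - k om of the raised exponent is zero, and with be = b + J so is
    the factor that multiplies the moment at b + J. *)
Definition kill_ops (om b : R) (d : nat) : list (R * R) :=
  map (fun J => (/ om, b + INR J)) (seq 0 d).

Lemma kill_ops_bound (om b Bm : R) (d : nat) p :
  1 <= Rabs om -> Rabs b <= 1 -> INR d <= Bm -> In p (kill_ops om b d) ->
  Rabs (fst p) <= 1 /\ Rabs (snd p) <= Bm.
Proof.
  intros Ho Hb HB Hp. apply in_map_iff in Hp. destruct Hp as (J & <- & HJ).
  apply in_seq in HJ. simpl. split.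
  - rewrite Rabs_inv, <- Rinv_1. apply Rinv_le_contravar; lra.
  - assert (INR (S J) <= INR d) by (apply le_INR; lia). rewrite S_INR in H.
    assert (0 <= INR J) by apply pos_INR.
    eapply Rle_trans; [apply Rabs_triang|]. rewrite (Rabs_pos_eq (INR J)); lra.
Qed.

(** At its own frequency such an operator acts diagonally: the moment at b + j is multiplied by a
    multiple of j - J. It creates a zero at j = J and loses none of the earlier ones. *)
Lemma null_kill_ops (om b Bm : R) (d : nat) : forall k K x,
  1 <= Rabs om -> Rabs b <= 1 -> INR d <= Bm ->
  test_pair (d + k) K (fst x) (snd x) ->
  null_at om b d (chain (kill_ops om b d) x).
Proof.
  induction d as [|d IH]; intros k K x Ho Hb HB Hx; [intros j Hj; lia|].
  unfold kill_ops. rewrite seq_S, map_app. unfold chain. rewrite fold_left_app.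
  fold (kill_ops om b d). fold (chain (kill_ops om b d) x). simpl.
  rewrite S_INR in HB.
  assert (Hc : test_pair (S k) (Nat.iter (length (kill_ops om b d)) (op_bound Bm) K)
     (fst (chain (kill_ops om b d) x)) (snd (chain (kill_ops om b d) x))).
  { apply chain_test_pair; [intros p Hp; eapply kill_ops_bound; eauto; lra|].
    unfold kill_ops at 1. rewrite length_map, length_seq.
    now rewrite Nat.add_succ_r. }
  assert (Hn : null_at om b d (chain (kill_ops om b d) x)).
  { apply (IH (S k) K); auto; [lra|]. now rewrite Nat.add_succ_r. }
  assert (Ho' : om <> 0) by (intros ->; rewrite Rabs_R0 in Ho; lra).
  intros j Hj.
  destruct (mom_op om (b + INR j) k _ (/ om, b + INR d) _ Hc) as [EA EB].
  rewrite EA, EB. simpl fst. simpl snd.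
  replace (1 - / om * om) with 0 by (field; assumption).
  destruct (Nat.eq_dec j d) as [->|Hne].
  - split; ring.
  - destruct (Hn j) as [A0 B0]; [lia|]. rewrite A0, B0. split; ring.
Qed.

(** This is 2^m - 1: the first frequency receives one operator more than all later frequencies
    together, so that one of its zeros survives them. *)
Fixpoint num_ops (m : nat) : nat :=
  match m with O => O | S m => S (num_ops m) + num_ops m end.

Fixpoint ops (l : list (R * R)) : list (R * R) :=
  match l with
  | nil => nil
  | (om, b) :: l => kill_ops om b (S (num_ops (length l))) ++ ops l
  end.

Lemma length_ops l : length (ops l) = num_ops (length l).
Proof.
  induction l as [|[om b] l IH]; [reflexivity|].
  cbn [ops length num_ops]. rewrite length_app, IH. unfold kill_ops.
  now rewrite length_map, length_seq.
Qed.

Definition admissible (p : R * R) : Prop := 1 <= Rabs (fst p) /\ Rabs (snd p) <= 1.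

Lemma ops_bound (Bm : R) l p :
  (forall q, In q l -> admissible q) -> INR (num_ops (length l)) <= Bm ->
  In p (ops l) -> Rabs (fst p) <= 1 /\ Rabs (snd p) <= Bm.
Proof.
  induction l as [|[om b] l IH]; intros Hl HB Hp; [destruct Hp|].
  cbn [ops] in Hp. apply in_app_or in Hp.
  cbn [length num_ops] in HB. rewrite plus_INR in HB.
  assert (P1 := pos_INR (S (num_ops (length l)))).
  assert (P2 := pos_INR (num_ops (length l))).
  destruct Hp as [Hp|Hp].
  - destruct (Hl (om, b)) as [H1 H2]; [now left|].
    refine (kill_ops_bound om b Bm _ p H1 H2 _ Hp). lra.
  - apply IH; auto; [intros q Hq; apply Hl; now right|lra].
Qed.

(* Each frequency is killed together with enough shifted exponents b + j to
   survive the operators applied afterwards, each of which costs one shift. *)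
Lemma null_ops (Bm : R) l : forall k K x,
  (forall q, In q l -> admissible q) -> INR (num_ops (length l)) <= Bm ->
  test_pair (length (ops l) + k) K (fst x) (snd x) ->
  forall om b, In (om, b) l -> null_at om b 1 (chain (ops l) x).
Proof.
  induction l as [|[om b] l IH]; intros k K x Hl HB Hx om' b' Hin; [destruct Hin|].
  cbn [ops] in *. unfold chain. rewrite fold_left_app.
  fold (chain (kill_ops om b (S (num_ops (length l)))) x).
  set (x1 := chain (kill_ops om b (S (num_ops (length l)))) x).
  fold (chain (ops l) x1).
  cbn [length num_ops] in HB. rewrite plus_INR in HB.
  assert (P1 := pos_INR (S (num_ops (length l)))).
  assert (P2 := pos_INR (num_ops (length l))).
  destruct (Hl (om, b)) as [H1 H2]; [now left|]. cbn [fst snd] in H1, H2.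
  rewrite length_app in Hx. rewrite <- Nat.add_assoc in Hx.
  assert (Hx1 := Hx). apply (chain_test_pair Bm) in Hx1.
  2:{ intros p Hp. refine (kill_ops_bound om b Bm _ p H1 H2 _ Hp). lra. }
  fold x1 in Hx1.
  assert (Hl' : forall q, In q l -> admissible q) by (intros q Hq; apply Hl; now right).
  destruct Hin as [E|Hin].
  - injection E as <- <-.
    refine (null_chain Bm om b (ops l) 1 k _ x1 _ Hx1 _).
    + intros p Hp. eapply ops_bound; eauto. lra.
    + rewrite length_ops, Nat.add_comm. change (1 + num_ops (length l))%nat with (S (num_ops (length l))).
      apply (null_kill_ops om b Bm _ (length (ops l) + k) K); [exact H1|exact H2| |]; [eapply Rle_trans; [|exact HB]; lra|].
      unfold kill_ops in Hx. rewrite length_map, length_seq in Hx. exact Hx.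
  - eapply IH; eauto. lra.
Qed.

(** * The polynomial bump from which the test function is built *)

(* The i-th derivative of (y - 1)^p (2 - y)^q. *)
Fixpoint bump (i p q : nat) (y : R) : R :=
  match i with
  | O => (y - 1) ^ p * (2 - y) ^ q
  | S i => INR p * bump i (pred p) q y - INR q * bump i p (pred q) y
  end.

Lemma bump_derive i : forall p q y, is_derive (bump i p q) y (bump (S i) p q y).
Proof.
  induction i as [|i IH]; intros p q y.
  - cbn [bump]. auto_derive; trivial. unfold Rminus; ring.
  - change (is_derive (fun y => INR p * bump i (pred p) q y - INR q * bump i p (pred q) y) y
      (INR p * bump (S i) (pred p) q y - INR q * bump (S i) p (pred q) y)).
    apply @is_derive_minus; apply @is_derive_scal; apply IH.
Qed.

Lemma bump_bound i : forall p q y, 1 <= y <= 2 -> Rabs (bump i p q y) <= INR (p + q) ^ i.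
Proof.
  induction i as [|i IH]; intros p q y Hy.
  - assert (P : forall n z, Rabs z <= 1 -> Rabs z ^ n <= 1).
    { intros n z Hz. rewrite <- (pow1 n). apply pow_incr. split; [apply Rabs_pos|assumption]. }
    simpl. rewrite Rabs_mult, <- !RPow_abs, <- (Rmult_1_l 1).
    apply Rmult_le_compat; try apply pow_le, Rabs_pos; apply P; rewrite Rabs_pos_eq; lra.
  - cbn [bump]. eapply Rle_trans; [apply Rabs_triang|].
    rewrite Rabs_Ropp, !Rabs_mult, !(Rabs_pos_eq (INR _)) by apply pos_INR.
    cbn [pow]. rewrite (plus_INR p q) at 1. rewrite Rmult_plus_distr_r.
    apply Rplus_le_compat; apply Rmult_le_compat_l; try apply pos_INR;
      (eapply Rle_trans; [now apply IH|]); apply pow_incr; split; try apply pos_INR;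
      apply le_INR; lia.
Qed.

Lemma bump_end i : forall p q, (i < p)%nat -> (i < q)%nat ->
  bump i p q 1 = 0 /\ bump i p q 2 = 0.
Proof.
  induction i as [|i IH]; intros p q Hp Hq.
  - simpl. split; [replace (1 - 1) with 0 by ring|replace (2 - 2) with 0 by ring];
    rewrite pow_i by lia; ring.
  - cbn [bump]. destruct (IH (pred p) q) as [E1 E2]; try lia.
    destruct (IH p (pred q)) as [E3 E4]; try lia.
    rewrite E1, E2, E3, E4. split; ring.
Qed.

(** The N-th derivative of ((y - 1)(2 - y))^(2N+1). The N derivatives make the moments of order
    below N vanish; N + 1 orders of vanishing at the end points remain, enough for N operators. *)
Definition start (N : nat) : (nat -> R -> R) * (nat -> R -> R) :=
  (fun i => bump (N + i) (2 * N + 1) (2 * N + 1), fun _ _ => 0).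

Lemma start_test_pair N :
  test_pair (N + 1) (fun i => INR (2 * N + 1 + (2 * N + 1)) ^ (N + i))
    (fst (start N)) (snd (start N)).
Proof.
  unfold start; cbn [fst snd]. split; [|split; [|split]].
  - intros i y. replace (N + S i)%nat with (S (N + i)) by lia. apply bump_derive.
  - intros i y. apply @is_derive_const.
  - intros i Hi. destruct (bump_end (N + i) (2 * N + 1) (2 * N + 1)); try lia. auto.
  - intros i y Hy. split; [now apply bump_bound|].
    rewrite Rabs_R0. apply pow_le, pos_INR.
Qed.

(** Integration by parts; the boundary terms vanish because i < p. For j = 0 the factor [INR j]
    makes the value of [pred j] immaterial. *)
Lemma bump_moment_step (p i j : nat) : (i < p)%nat ->
  moment 0 (INR j) (bump (S i) p p) (fun _ => 0) =
  - INR j * moment 0 (INR (pred j)) (bump i p p) (fun _ => 0).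
Proof.
  intros Hi. destruct (bump_end i p p Hi Hi) as [E1 E2].
  assert (Cb : forall i y, continuous (bump i p p) y).
  { intros k. apply (cont_of_derive _ (bump (S k) p p)). intros z; apply bump_derive. }
  assert (C0 : forall y : R, continuous (fun _ : R => 0) y) by (intros; apply continuous_const).
  apply is_RInt_unique.
  assert (HF : is_RInt (fun y => Rpower y (INR j) * bump (S i) p p y
      + INR j * (Rpower y (INR (pred j)) * bump i p p y)) 1 2
      (minus (Rpower 2 (INR j) * bump i p p 2) (Rpower 1 (INR j) * bump i p p 1))).
  { apply (is_RInt_derive (fun y => Rpower y (INR j) * bump i p p y)).
    - intros y Hy. rewrite Rmin_left, Rmax_right in Hy by lra.
      assert (Eb : Derive (fun z : R => bump i p p z) y = bump (S i) p p y)
        by apply is_derive_unique, bump_derive.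
      unfold Rpower. auto_derive.
      + repeat split; try lra. exists (bump (S i) p p y). apply bump_derive.
      + rewrite Eb. destruct j as [|j]; [simpl; ring|].
        rewrite S_INR. cbn [pred].
        replace ((INR j + 1) * ln y) with (INR j * ln y + ln y) by ring.
        rewrite exp_plus, exp_ln by lra. field. lra.
    - intros y Hy. rewrite Rmin_left, Rmax_right in Hy by lra.
      apply continuous_Rplus; [|apply continuous_Rmult; [apply continuous_const|]];
        (apply continuous_Rmult; [apply continuous_Rpower; lra|apply Cb]). }
  rewrite E1, E2 in HF.
  replace (- INR j * moment 0 (INR (pred j)) (bump i p p) (fun _ => 0)) with
    (plus (minus (Rpower 2 (INR j) * 0) (Rpower 1 (INR j) * 0))
      (scal (- INR j) (moment 0 (INR (pred j)) (bump i p p) (fun _ => 0)))).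
  2:{ unfold plus, scal, minus, plus, opp; simpl; unfold mult; simpl. ring. }
  eapply is_RInt_ext.
  2:{ apply @is_RInt_plus; [apply HF|apply @is_RInt_scal; apply moment_correct; auto]. }
  intros y _. unfold plus, scal; simpl; unfold mult; simpl.
  rewrite Rmult_0_l, cos_0, sin_0. ring.
Qed.

(** Repeated integration by parts meets the factor 0 when j < N. For j = N it leaves (-1)^N N! times
    the integral of ((y - 1)(2 - y))^p, which is positive. *)
Lemma bump_moments (p N : nat) : (N <= p)%nat ->
  (forall j, (j < N)%nat -> moment 0 (INR j) (bump N p p) (fun _ => 0) = 0) /\
  moment 0 (INR N) (bump N p p) (fun _ => 0) <> 0.
Proof.
  induction N as [|N IH]; intros HN.
  - split; [intros; lia|]. apply Rgt_not_eq. apply RInt_gt_0; [lra| |].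
    + intros y Hy. rewrite Rmult_0_l, cos_0, sin_0. cbn [bump].
      apply Rmult_lt_0_compat; [apply exp_pos|]. rewrite Rmult_0_r, Rplus_0_r, Rmult_1_l.
      apply Rmult_lt_0_compat; apply pow_lt; lra.
    + intros y Hy. apply moment_cont; [lra| |apply continuous_const].
      apply (cont_of_derive _ (bump 1 p p)). intros; apply bump_derive.
  - destruct IH as [H1 H2]; [lia|]. split.
    + intros j Hj. rewrite bump_moment_step by lia.
      destruct j as [|j]; [simpl; ring|]. cbn [pred]. rewrite H1 by lia. ring.
    + rewrite bump_moment_step by lia. cbn [pred]. apply Rmult_integral_contrapositive.
      split; [|assumption]. apply Ropp_neq_0_compat, not_0_INR. lia.
Qed.

(** * The uniform L^1 lower bound on [1,2] *)

(** An entry (v, (om, b)) stands for v y^b e^{i om y}. Then [trig_re l y * u y + trig_im l y * w y]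
    is the real part of chi times the conjugate sum, a linear combination of integrands of
    [moment]. *)
Definition trig_re (l : list (R * (R * R))) (y : R) : R :=
  fold_right (fun p acc => fst p * (Rpower y (snd (snd p)) * cos (fst (snd p) * y)) + acc) 0 l.
Definition trig_im (l : list (R * (R * R))) (y : R) : R :=
  fold_right (fun p acc => fst p * (Rpower y (snd (snd p)) * sin (fst (snd p) * y)) + acc) 0 l.

Lemma trig_moment l u w :
  (forall y, continuous u y) -> (forall y, continuous w y) ->
  (forall v om b, In (v, (om, b)) l -> moment om b u w = 0) ->
  is_RInt (fun y => trig_re l y * u y + trig_im l y * w y) 1 2 0.
Proof.
  intros Hu Hw. induction l as [|[v [om b]] l IH]; intros Hl.
  - apply (is_RInt_ext (fun _ => 0)); [intros; simpl; ring|].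
    assert (E := @is_RInt_const R_NormedModule 1 2 0).
    unfold scal in E; simpl in E; unfold mult in E; simpl in E.
    now rewrite Rmult_0_r in E.
  - replace 0 with (plus (scal v (moment om b u w)) 0).
    2:{ rewrite (Hl v om b) by now left. unfold plus, scal; simpl; unfold mult; simpl; ring. }
    eapply is_RInt_ext; [|apply @is_RInt_plus;
      [apply @is_RInt_scal, moment_correct; auto|apply IH]].
    + intros y _. unfold plus, scal; simpl; unfold mult; simpl. ring.
    + intros v' om' b' H. apply (Hl v' om' b'). now right.
Qed.

Lemma trig_cont l y : 0 < y -> continuous (trig_re l) y /\ continuous (trig_im l) y.
Proof.
  intros Hy. induction l as [|[v [om b]] l [IH1 IH2]].
  - split; apply continuous_const.
  - split; (apply continuous_Rplus; [|assumption]);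
    (apply continuous_Rmult; [apply continuous_const|]);
    (apply continuous_Rmult; [now apply continuous_Rpower|]);
    apply @ex_derive_continuous; auto_derive; trivial.
Qed.
Lemma trig_mod_cont l y : 0 < y ->
  continuous (fun y => sqrt ((1 + trig_re l y) ^ 2 + trig_im l y ^ 2)) y.
Proof.
  intros Hy. destruct (trig_cont l y Hy) as [C1 C2].
  assert (C3 : continuous (fun y => 1 + trig_re l y) y)
    by (apply continuous_Rplus; [apply continuous_const|assumption]).
  apply (continuous_comp (fun y => (1 + trig_re l y) ^ 2 + trig_im l y ^ 2) sqrt).
  - apply (continuous_ext (fun y => (1 + trig_re l y) * (1 + trig_re l y)
        + trig_im l y * trig_im l y)); [intros; simpl; ring|].
    apply continuous_Rplus; apply continuous_Rmult; assumption.
  - apply continuous_sqrt.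
Qed.

(** Duality: the test function chi produced by the chain is orthogonal to all terms of the sum,
    while the real part of its integral is [mu]. Pairing chi with 1 plus the sum therefore gives
    [mu], which is at most a bound for chi times the L^1 norm. *)
Lemma trig_lower_bound (m : nat) :
  exists c, 0 < c /\ forall l : list (R * (R * R)), length l = m ->
    (forall q, In q (map snd l) -> admissible q) ->
    c <= RInt (fun y => sqrt ((1 + trig_re l y) ^ 2 + trig_im l y ^ 2)) 1 2.
Proof.
  set (N := num_ops m).
  set (Bm := INR N).
  set (K := Nat.iter N (op_bound Bm) (fun i => INR (2 * N + 1 + (2 * N + 1)) ^ (N + i))).
  set (mu := momA 0 (INR N) (start N)).
  assert (Hmom := bump_moments (2 * N + 1) N ltac:(lia)).
  assert (Cb : forall i p q y, continuous (bump i p q) y).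
  { intros i p q. apply (cont_of_derive _ (bump (S i) p q)). intros z; apply bump_derive. }
  assert (Cz : forall z : R, continuous (fun _ : R => 0) z) by (intros; apply continuous_const).
  assert (Hmu : mu <> 0).
  { unfold mu, momA, start. cbn [fst snd]. rewrite Nat.add_0_r. apply Hmom. }
  assert (Hnull : null_at 0 0 N (start N)).
  { intros j Hj. rewrite Rplus_0_l. unfold momA, momB, start. cbn [fst snd].
    rewrite Nat.add_0_r. split; [now apply Hmom|].
    apply is_RInt_unique. apply (is_RInt_ext (fun _ => 0)).
    - intros y _. rewrite Rmult_0_l, sin_0. simpl; ring.
    - assert (E := @is_RInt_const R_NormedModule 1 2 0).
      unfold scal in E; simpl in E; unfold mult in E; simpl in E.
      now rewrite Rmult_0_r in E. }
  (* Both components of chi are bounded by [K O], and the pairing has two products, whence the 2;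
     the added 1 keeps the denominator positive. *)
  exists (Rabs mu / (2 * (1 + Rabs (K O)))).
  assert (HK0 := Rabs_pos (K O)). assert (Hamu : 0 < Rabs mu) by now apply Rabs_pos_lt.
  split; [apply Rdiv_lt_0_compat; lra|].
  intros l Hlen Hadm.
  set (cs := ops (map snd l)).
  assert (Lcs : length cs = N) by (unfold cs; rewrite length_ops, length_map, Hlen; reflexivity).
  assert (Hcs : forall p, In p cs -> Rabs (fst p) <= 1 /\ Rabs (snd p) <= Bm).
  { intros p Hp. eapply ops_bound; eauto. rewrite length_map, Hlen. apply Rle_refl. }
  assert (Hst := start_test_pair N). rewrite <- Lcs in Hst at 1.
  assert (Hch := chain_test_pair Bm cs 1 _ _ Hcs Hst). rewrite Lcs in Hch. fold K in Hch.
  assert (Hval : momA 0 0 (chain cs (start N)) = mu).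
  { assert (Hn' : null_at 0 0 (length cs + 0) (start N)) by (rewrite Lcs, Nat.add_0_r; exact Hnull).
    assert (E := target_chain Bm cs 0 1 _ _ Hcs Hst Hn').
    rewrite Lcs, Nat.add_0_r in E. exact E. }
  assert (Hzero : forall om b, In (om, b) (map snd l) -> momA om b (chain cs (start N)) = 0).
  { intros om b Hin. assert (HB : INR (num_ops (length (map snd l))) <= Bm)
      by (rewrite length_map, Hlen; apply Rle_refl).
    destruct (null_ops Bm (map snd l) 1 _ _ Hadm HB Hst om b Hin 0%nat) as [E _]; [lia|].
    now rewrite Rplus_0_r in E. }
  destruct (chain cs (start N)) as [u w]. unfold momA in Hval, Hzero. cbn [fst snd] in *.
  destruct Hch as (Ju & Jw & _ & HKb).
  assert (Cu : forall y, continuous (u O) y) by (intros; now apply is_jet_cont).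
  assert (Cw : forall y, continuous (w O) y) by (intros; now apply is_jet_cont).
  assert (I1 := moment_correct 0 0 _ _ Cu Cw). rewrite Hval in I1.
  assert (I2 : is_RInt (fun y => trig_re l y * u O y + trig_im l y * w O y) 1 2 0).
  { apply trig_moment; auto. intros v om b Hin. apply Hzero.
    change (om, b) with (snd (v, (om, b))). now apply in_map. }
  assert (I3 := is_RInt_plus _ _ _ _ _ _ I1 I2).
  unfold plus in I3; simpl in I3. rewrite Rplus_0_r in I3.
  set (G := fun y => sqrt ((1 + trig_re l y) ^ 2 + trig_im l y ^ 2)).
  assert (CG : forall y, 1 <= y <= 2 -> continuous G y)
    by (intros y Hy; apply trig_mod_cont; lra).
  assert (IG : is_RInt G 1 2 (RInt G 1 2)).
  { apply (@RInt_correct R_CompleteNormedModule).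
    apply (@ex_RInt_continuous R_CompleteNormedModule). intros z Hz.
    rewrite Rmin_left, Rmax_right in Hz by lra. now apply CG. }
  set (c2 := 2 * (1 + Rabs (K O))) in *.
  assert (I4 : is_RInt (fun y => c2 * G y) 1 2 (c2 * RInt G 1 2)).
  { apply (@is_RInt_scal R_NormedModule). exact IG. }
  assert (Hle : Rabs mu <= c2 * RInt G 1 2).
  { refine (@norm_RInt_le R_NormedModule _ _ 1 2 mu _ _ _ I3 I4); [lra|].
    intros y Hy. destruct (HKb O y Hy) as [Bu Bw].
    unfold norm; simpl. unfold abs; simpl.
    rewrite Rmult_0_l, cos_0, sin_0. rewrite Rpower_O by lra.
    replace (1 * (1 * u O y + 0 * w O y) + (trig_re l y * u O y + trig_im l y * w O y))
      with ((1 + trig_re l y) * u O y + trig_im l y * w O y) by ring.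
    unfold G. set (P := 1 + trig_re l y). set (Q := trig_im l y).
    assert (HP : Rabs P <= sqrt (P ^ 2 + Q ^ 2)).
    { rewrite <- sqrt_Rsqr_abs. apply sqrt_le_1_alt. unfold Rsqr. nra. }
    assert (HQ : Rabs Q <= sqrt (P ^ 2 + Q ^ 2)).
    { rewrite <- sqrt_Rsqr_abs. apply sqrt_le_1_alt. unfold Rsqr. nra. }
    eapply Rle_trans; [apply Rabs_triang|]. rewrite !Rabs_mult.
    assert (HK : K O <= Rabs (K O)) by apply Rle_abs.
    assert (0 <= Rabs P) by apply Rabs_pos. assert (0 <= Rabs Q) by apply Rabs_pos.
    assert (0 <= Rabs (u O y)) by apply Rabs_pos. assert (0 <= Rabs (w O y)) by apply Rabs_pos.
    unfold c2. set (s := sqrt (P ^ 2 + Q ^ 2)) in *.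
    assert (Rabs P * Rabs (u O y) <= s * (1 + Rabs (K O))) by (apply Rmult_le_compat; lra).
    assert (Rabs Q * Rabs (w O y) <= s * (1 + Rabs (K O))) by (apply Rmult_le_compat; lra).
    lra. }
  apply (Rmult_le_reg_l c2); [unfold c2; lra|].
  replace (c2 * (Rabs mu / c2)) with (Rabs mu) by (field; unfold c2; lra). assumption.
Qed.

(** * The norm as an integral over compact intervals *)

Lemma Rpower_gt0 (x a : R) : 0 < Rpower x a.
Proof. apply exp_pos. Qed.

Lemma rpow_pos (x a : R) : 0 < x -> rpow x a = Rpower x a.
Proof. intros H. unfold rpow. destruct (Rlt_dec 0 x); [reflexivity|contradiction]. Qed.

Lemma rpow_0 (x a : R) : x <= 0 -> rpow x a = 0.
Proof. intros H. unfold rpow. destruct (Rlt_dec 0 x); [lra|reflexivity]. Qed.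

Lemma rpow_ge0 (x a : R) : 0 <= rpow x a.
Proof. unfold rpow. destruct (Rlt_dec 0 x); [left; apply Rpower_gt0|lra]. Qed.

Lemma rpow_le (x y a : R) : 0 <= a -> x <= y -> rpow x a <= rpow y a.
Proof.
  intros Ha Hxy. destruct (Rle_dec x 0).
  - rewrite rpow_0 by assumption. apply rpow_ge0.
  - rewrite !rpow_pos by lra. apply Rle_Rpower_l; lra.
Qed.

Lemma rpow_mult (x y a : R) : 0 < x -> 0 <= y -> rpow (x * y) a = Rpower x a * rpow y a.
Proof.
  intros Hx Hy. destruct (Req_dec y 0) as [->|Hn].
  - rewrite Rmult_0_r, !rpow_0 by lra. ring.
  - rewrite !rpow_pos; try nra. symmetry. apply Rpower_mult_distr; lra.
Qed.

Lemma Rpower_le_exp_ge1 (x a b : R) : 1 <= x -> a <= b -> Rpower x a <= Rpower x b.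
Proof.
  intros Hx Hab. unfold Rpower.
  assert (0 <= ln x) by (rewrite <- ln_1; apply ln_le; lra).
  destruct (Rle_lt_or_eq_dec (a * ln x) (b * ln x)) as [H0|H0]; [nra| |].
  - left. now apply exp_increasing.
  - rewrite H0. apply Rle_refl.
Qed.

Lemma Rpower_le_exp_le1 (x a b : R) : 0 < x <= 1 -> a <= b -> Rpower x b <= Rpower x a.
Proof.
  intros Hx Hab. unfold Rpower.
  assert (ln x <= 0) by (rewrite <- ln_1; apply ln_le; lra).
  destruct (Rle_lt_or_eq_dec (b * ln x) (a * ln x)) as [H0|H0]; [nra| |].
  - left. now apply exp_increasing.
  - rewrite H0. apply Rle_refl.
Qed.

Lemma rpow_continuous (a x : R) : 0 < a -> continuous (fun y => rpow y a) x.
Proof.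
  intros Ha. destruct (Rtotal_order x 0) as [Hx|[Hx|Hx]].
  - apply (continuous_ext_loc _ (fun _ => 0)); [|apply continuous_const].
    exists (mkposreal (- x) ltac:(lra)). intros y Hy.
    unfold ball in Hy; simpl in Hy; unfold AbsRing_ball, abs, minus, plus, opp in Hy; simpl in Hy.
    apply Rabs_def2 in Hy. rewrite rpow_0; [reflexivity|lra].
  - subst x. intros P [eps HP]. rewrite rpow_0 in HP by lra.
    (* The radius eps^(1/a) solves y^a = eps. *)
    exists (mkposreal (Rpower eps (/ a)) (Rpower_gt0 _ _)). intros y Hy. apply HP.
    unfold ball in Hy |- *; simpl in Hy |- *;
      unfold AbsRing_ball, abs, minus, plus, opp in Hy |- *; simpl in Hy |- *.
    rewrite Ropp_0, Rplus_0_r in Hy |- *.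
    rewrite (Rabs_pos_eq (rpow y a)) by apply rpow_ge0.
    destruct (Rle_dec y 0); [rewrite rpow_0 by assumption; apply cond_pos|].
    rewrite rpow_pos by lra. rewrite Rabs_pos_eq in Hy by lra.
    replace (pos eps) with (Rpower (Rpower eps (/ a)) a).
    + unfold Rpower at 1 2. apply exp_increasing. apply Rmult_lt_compat_l; [assumption|].
      apply ln_increasing; [lra|assumption].
    + rewrite Rpower_mult, Rinv_l by lra. apply Rpower_1, cond_pos.
  - apply (continuous_ext_loc _ (fun y => Rpower y a)).
    + exists (mkposreal x Hx). intros y Hy.
      unfold ball in Hy; simpl in Hy; unfold AbsRing_ball, abs, minus, plus, opp in Hy; simpl in Hy.
      apply Rabs_def2 in Hy. rewrite rpow_pos; [reflexivity|lra].
    + now apply continuous_Rpower.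
Qed.

Definition kern_mod (alpha : R) (H : R -> R) (l : list (R * R)) (x : R) : R :=
  sqrt (kern_re alpha H l x ^ 2 + kern_im alpha H l x ^ 2).

Lemma kern_opp alpha H l x :
  kern_re alpha H l (- x) = kern_re alpha H l x /\
  kern_im alpha H l (- x) = - kern_im alpha H l x.
Proof.
  unfold kern_re, kern_im.
  induction l as [|[c t] l [IH1 IH2]]; [simpl; lra|].
  cbn [fold_right fst snd]. rewrite IH1, IH2, Rabs_Ropp, Ropp_mult_distr_r_reverse, cos_neg, sin_neg.
  split; [reflexivity|]. unfold Rdiv. ring.
Qed.

Lemma kern_abs_pow_even alpha H l x :
  kern_abs_pow alpha H l (- x) = kern_abs_pow alpha H l x.
Proof.
  unfold kern_abs_pow. destruct (kern_opp alpha H l x) as [-> ->]. do 2 f_equal. ring.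
Qed.

Lemma kern_cont alpha H l x : 0 < x ->
  continuous (kern_re alpha H l) x /\ continuous (kern_im alpha H l) x.
Proof.
  intros Hx. induction l as [|[c t] l [IH1 IH2]].
  - split; apply continuous_const.
  - assert (Hp : continuous (fun y => / Rpower (Rabs y) (/ alpha + H t)) x).
    { apply (continuous_ext_loc _ (fun y => Rpower y (- (/ alpha + H t)))).
      - exists (mkposreal x Hx). intros y Hy.
        unfold ball in Hy; simpl in Hy; unfold AbsRing_ball, abs, minus, plus, opp in Hy; simpl in Hy.
        apply Rabs_def2 in Hy. rewrite Rpower_Ropp, Rabs_pos_eq; [reflexivity|lra].
      - now apply continuous_Rpower. }
    split; (apply continuous_Rplus; [|assumption]);
      (apply continuous_Rmult; [|exact Hp]);
      apply @ex_derive_continuous; auto_derive; trivial.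
Qed.

Lemma kern_abs_pow_cont alpha H l x : 0 < alpha -> 0 < x ->
  continuous (kern_abs_pow alpha H l) x.
Proof.
  intros Ha Hx. destruct (kern_cont alpha H l x Hx) as [C1 C2].
  apply (continuous_comp (kern_mod alpha H l) (fun y => rpow y alpha)).
  - apply (continuous_comp (fun x => kern_re alpha H l x ^ 2 + kern_im alpha H l x ^ 2) sqrt).
    + apply (continuous_ext (fun y => kern_re alpha H l y * kern_re alpha H l y
        + kern_im alpha H l y * kern_im alpha H l y)); [intros; simpl; ring|].
      apply continuous_Rplus; apply continuous_Rmult; assumption.
    + apply continuous_sqrt.
  - now apply rpow_continuous.
Qed.

Lemma ex_RInt_pos (f : R -> R) (a b : R) : 0 < a -> 0 < b ->
  (forall x, 0 < x -> continuous f x) -> ex_RInt f a b.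
Proof.
  intros Ha Hb Hf. apply (@ex_RInt_continuous R_CompleteNormedModule). intros z Hz.
  apply Hf. apply Rlt_le_trans with (Rmin a b); [now apply Rmin_glb_lt|apply Hz].
Qed.

(** The kernel at -x is the conjugate of the kernel at x, so both half-lines contribute equally. *)
Lemma partial_integrals_iff alpha H l v : 0 < alpha ->
  partial_integrals (kern_abs_pow alpha H l) v <->
  exists a b, 0 < a < b /\ v = 2 * RInt (kern_abs_pow alpha H l) a b.
Proof.
  intros Ha. set (h := kern_abs_pow alpha H l).
  assert (Ch : forall x, 0 < x -> continuous h x)
    by (intros; now apply kern_abs_pow_cont).
  assert (I : forall a b, 0 < a < b -> is_RInt h (- b) (- a) (RInt h a b)).
  { intros a b Hab.
    assert (E : is_RInt (fun y => opp (h (- y))) (- b) (- a) (RInt h b a)).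
    { apply (@is_RInt_comp_opp R_NormedModule). rewrite !Ropp_involutive.
      apply (@RInt_correct R_CompleteNormedModule). apply ex_RInt_pos; auto; lra. }
    apply @is_RInt_opp in E.
    replace (RInt h a b) with (opp (RInt h b a)).
    - eapply is_RInt_ext; [|exact E]. intros x _. unfold opp; simpl. rewrite Ropp_involutive. apply kern_abs_pow_even.
    - apply (@opp_RInt_swap R_CompleteNormedModule). apply ex_RInt_pos; auto; lra. }
  split.
  - intros (a & b & Hab & pr1 & pr2 & ->). exists a, b. split; [assumption|].
    rewrite <- !RInt_Reals. rewrite (is_RInt_unique _ _ _ _ (I a b Hab)). ring.
  - intros (a & b & Hab & ->). exists a, b. split; [assumption|].
    assert (E1 : ex_RInt h (- b) (- a)) by (eexists; apply I, Hab).
    assert (E2 : ex_RInt h a b) by (apply ex_RInt_pos; auto; lra).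
    exists (ex_RInt_Reals_0 _ _ _ E1), (ex_RInt_Reals_0 _ _ _ E2).
    rewrite <- !RInt_Reals, (is_RInt_unique _ _ _ _ (I a b Hab)). ring.
Qed.

Lemma sup_or0_ge (E : R -> Prop) v : bound E -> E v -> v <= sup_or0 E.
Proof.
  intros Hb Hv. unfold sup_or0.
  destruct (ClassicalEpsilon.excluded_middle_informative _) as [h|n].
  - destruct (completeness E _ _) as [m Hm]. simpl. now apply Hm.
  - exfalso. apply n. split; [assumption|now exists v].
Qed.

Lemma sup_or0_le (E : R -> Prop) K : 0 <= K -> (forall v, E v -> v <= K) -> sup_or0 E <= K.
Proof.
  intros H0 HK. unfold sup_or0.
  destruct (ClassicalEpsilon.excluded_middle_informative _) as [h|n]; [|assumption].
  destruct (completeness E _ _) as [m Hm]. simpl. apply Hm. intros v Hv. now apply HK.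
Qed.

Lemma Lalpha_pow_le alpha H l K : 0 < alpha -> 0 <= K ->
  (forall a b, 0 < a < b -> RInt (kern_abs_pow alpha H l) a b <= K) ->
  Lalpha_pow alpha H l <= 2 * K.
Proof.
  intros Ha HK Hb. apply sup_or0_le; [lra|]. intros v Hv.
  apply partial_integrals_iff in Hv; [|assumption]. destruct Hv as (a & b & Hab & ->).
  specialize (Hb a b Hab). lra.
Qed.

(** The uniform bound [K] guarantees that [sup_or0] is the actual supremum and not its default value
    0. *)
Lemma Lalpha_pow_ge alpha H l K a b : 0 < alpha -> 0 < a < b ->
  (forall a b, 0 < a < b -> RInt (kern_abs_pow alpha H l) a b <= K) ->
  2 * RInt (kern_abs_pow alpha H l) a b <= Lalpha_pow alpha H l.
Proof.
  intros Ha Hab Hb. apply sup_or0_ge.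
  - exists (2 * K). intros v Hv. apply partial_integrals_iff in Hv; [|assumption].
    destruct Hv as (a' & b' & Hab' & ->). specialize (Hb a' b' Hab'). lra.
  - apply partial_integrals_iff; [assumption|]. now exists a, b.
Qed.

(** * Integrable power majorants *)

Definition power_majorant (P p Q q x : R) : R := Rmin (P * Rpower x p) (Q * Rpower x (- q)) / x.

Lemma continuous_Rmin (f g : R -> R) (x : R) :
  continuous f x -> continuous g x -> continuous (fun y => Rmin (f y) (g y)) x.
Proof.
  intros Hf Hg.
  apply (continuous_ext (fun y => (f y + g y - Rabs (f y - g y)) * / 2)).
  - intros y. unfold Rmin, Rabs. destruct Rle_dec, Rcase_abs; lra.
  - apply continuous_Rmult; [|apply continuous_const].
    apply continuous_Rminus; [now apply continuous_Rplus|].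
    apply (continuous_comp (fun y => f y - g y) Rabs); [now apply continuous_Rminus|].
    apply continuous_Rabs.
Qed.

Lemma power_majorant_cont P p Q q x : 0 < x -> continuous (power_majorant P p Q q) x.
Proof.
  intros Hx. apply continuous_Rmult.
  - apply continuous_Rmin; (apply continuous_Rmult; [apply continuous_const|now apply continuous_Rpower]).
  - apply @ex_derive_continuous. auto_derive. lra.
Qed.

Lemma RInt_Rpower_over (P p a b : R) : p <> 0 -> 0 < a -> 0 < b ->
  is_RInt (fun x => P * Rpower x p / x) a b (P * (Rpower b p - Rpower a p) / p).
Proof.
  intros Hp Ha Hb.
  replace (P * (Rpower b p - Rpower a p) / p) with
    (minus (P * Rpower b p / p) (P * Rpower a p / p)).
  2:{ unfold minus, plus, opp; simpl. field. assumption. }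
  assert (Hpos : forall x, Rmin a b <= x <= Rmax a b -> 0 < x).
  { intros x Hx. apply Rlt_le_trans with (Rmin a b); [now apply Rmin_glb_lt|apply Hx]. }
  apply (is_RInt_derive (fun x => P * Rpower x p / p)).
  - intros x Hx. apply Hpos in Hx. unfold Rpower. auto_derive; [assumption|]. field. lra.
  - intros x Hx. apply Hpos in Hx.
    apply continuous_Rmult;
      [apply continuous_Rmult; [apply continuous_const|now apply continuous_Rpower]|].
    apply @ex_derive_continuous. auto_derive. lra.
Qed.

(** Below [r] the integrand is at most its P-branch, integrable at 0; above [r] at most its
    Q-branch, integrable at infinity. The point [r] is left free so that it can follow the scale of
    an increment. *)
Lemma power_majorant_int (P p Q q r a b : R) : 0 <= P -> 0 <= Q -> 0 < p -> 0 < q -> 0 < r -> 0 < a <= b ->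
  RInt (power_majorant P p Q q) a b <= P * Rpower r p / p + Q * Rpower r (- q) / q.
Proof.
  intros HP HQ Hp Hq Hr Hab.
  assert (Ex : forall a b, 0 < a -> 0 < b -> ex_RInt (power_majorant P p Q q) a b).
  { intros. apply ex_RInt_pos; auto. intros; now apply power_majorant_cont. }
  assert (HPp : 0 <= P / p) by (apply Rdiv_le_0_compat; assumption).
  assert (HQq : 0 <= Q / q) by (apply Rdiv_le_0_compat; assumption).
  assert (Lo : forall a c, 0 < a <= c -> c <= r ->
    RInt (power_majorant P p Q q) a c <= P * Rpower r p / p).
  { intros a' c Hac Hc.
    apply Rle_trans with (P * (Rpower c p - Rpower a' p) / p).
    - refine (is_RInt_le _ _ a' c _ _ _ (RInt_correct _ _ _ (Ex a' c _ _))
        (RInt_Rpower_over P p a' c _ _ _) _); try lra.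
      intros x Hx. apply Rmult_le_compat_r; [left; apply Rinv_0_lt_compat; lra|apply Rmin_l].
    - assert (Rpower c p <= Rpower r p) by (apply Rle_Rpower_l; lra).
      assert (0 < Rpower a' p) by apply Rpower_gt0.
      unfold Rdiv in *. rewrite !(Rmult_comm P), !Rmult_assoc. apply Rmult_le_compat_r; lra. }
  assert (Hi : forall c b, 0 < c <= b -> r <= c ->
    RInt (power_majorant P p Q q) c b <= Q * Rpower r (- q) / q).
  { intros c b' Hcb Hc.
    apply Rle_trans with (Q * (Rpower b' (- q) - Rpower c (- q)) / (- q)).
    - refine (is_RInt_le _ _ c b' _ _ _ (RInt_correct _ _ _ (Ex c b' _ _))
        (RInt_Rpower_over Q (- q) c b' _ _ _) _); try lra.
      intros x Hx. apply Rmult_le_compat_r; [left; apply Rinv_0_lt_compat; lra|apply Rmin_r].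
    - assert (Rpower c (- q) <= Rpower r (- q)).
      { rewrite !Rpower_Ropp. apply Rinv_le_contravar; [apply Rpower_gt0|apply Rle_Rpower_l; lra]. }
      assert (0 < Rpower b' (- q)) by apply Rpower_gt0.
      replace (Q * (Rpower b' (- q) - Rpower c (- q)) / - q) with
        ((Rpower c (- q) - Rpower b' (- q)) * (Q / q)) by (field; lra).
      replace (Q * Rpower r (- q) / q) with (Rpower r (- q) * (Q / q)) by (field; lra).
      apply Rmult_le_compat_r; lra. }
  assert (0 <= P * Rpower r p / p).
  { replace (P * Rpower r p / p) with (P / p * Rpower r p) by (field; lra).
    apply Rmult_le_pos; [assumption|left; apply Rpower_gt0]. }
  assert (0 <= Q * Rpower r (- q) / q).
  { replace (Q * Rpower r (- q) / q) with (Q / q * Rpower r (- q)) by (field; lra).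
    apply Rmult_le_pos; [assumption|left; apply Rpower_gt0]. }
  destruct (Rle_dec b r).
  - specialize (Lo a b). lra.
  - destruct (Rle_dec r a).
    + specialize (Hi a b). lra.
    + assert (C := RInt_Chasles (power_majorant P p Q q) a r b (Ex a r ltac:(lra) ltac:(lra))
        (Ex r b ltac:(lra) ltac:(lra))).
      unfold plus in C; simpl in C. rewrite <- C.
      specialize (Lo a r). specialize (Hi r b). lra.
Qed.

(** * Upper bounds for the kernel *)

Lemma sqrt_sum_sq_le (u v M : R) :
  Rabs u <= M -> Rabs v <= M -> sqrt (u ^ 2 + v ^ 2) <= 2 * M.
Proof.
  intros Hu Hv. assert (0 <= M) by (eapply Rle_trans; [apply Rabs_pos|exact Hu]).
  rewrite <- (sqrt_Rsqr (2 * M)) by lra. apply sqrt_le_1_alt. unfold Rsqr.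
  rewrite <- (pow2_abs u), <- (pow2_abs v).
  assert (0 <= Rabs u) by apply Rabs_pos. assert (0 <= Rabs v) by apply Rabs_pos. nra.
Qed.

Lemma rpow_Rmin_le (alpha P p Q q x : R) : 0 < alpha -> 0 < P -> 0 < Q -> 0 < x ->
  rpow (Rmin (P * Rpower x p) (Q * Rpower x (- q))) alpha * / x <=
  power_majorant (Rpower P alpha) (alpha * p) (Rpower Q alpha) (alpha * q) x.
Proof.
  intros Ha HP HQ Hx. assert (Hi := Rinv_0_lt_compat x Hx).
  apply Rmult_le_compat_r; [lra|].
  assert (E : forall P p, 0 < P -> rpow (P * Rpower x p) alpha = Rpower P alpha * Rpower x (alpha * p)).
  { intros P' p' HP'. rewrite rpow_mult by (try assumption; left; apply Rpower_gt0).
    rewrite rpow_pos by apply Rpower_gt0. rewrite Rpower_mult. f_equal. f_equal. ring. }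
  replace (- (alpha * q)) with (alpha * - q) by ring.
  rewrite <- !E by assumption.
  apply Rmin_glb; apply rpow_le; try lra; [apply Rmin_l|apply Rmin_r].
Qed.

Definition kern_bound_value (alpha P1 p1 Q1 q1 r1 P2 p2 Q2 q2 r2 : R) : R :=
  Rpower 4 alpha *
    ((Rpower P1 alpha * Rpower r1 (alpha * p1) / (alpha * p1)
      + Rpower Q1 alpha * Rpower r1 (- (alpha * q1)) / (alpha * q1))
   + (Rpower P2 alpha * Rpower r2 (alpha * p2) / (alpha * p2)
      + Rpower Q2 alpha * Rpower r2 (- (alpha * q2)) / (alpha * q2))).

(** With A and B the two minima, the modulus is at most 2 x^(-1/alpha) (A + B) <= 4 x^(-1/alpha)
    max(A, B). The power alpha turns x^(-1/alpha) into 1/x, and max(A, B)^alpha is at most the sum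
    of both powers. *)
Lemma kern_int_bound (alpha : R) (H : R -> R) (l : list (R * R))
  (P1 p1 Q1 q1 r1 P2 p2 Q2 q2 r2 : R) :
  0 < alpha -> 0 < P1 -> 0 < p1 -> 0 < Q1 -> 0 < q1 -> 0 < r1 ->
  0 < P2 -> 0 < p2 -> 0 < Q2 -> 0 < q2 -> 0 < r2 ->
  (forall x, 0 < x ->
     let M := Rmin (P1 * Rpower x p1) (Q1 * Rpower x (- q1))
              + Rmin (P2 * Rpower x p2) (Q2 * Rpower x (- q2)) in
     Rabs (kern_re alpha H l x) <= Rpower x (- / alpha) * M /\
     Rabs (kern_im alpha H l x) <= Rpower x (- / alpha) * M) ->
  forall a b, 0 < a < b -> RInt (kern_abs_pow alpha H l) a b <=
    kern_bound_value alpha P1 p1 Q1 q1 r1 P2 p2 Q2 q2 r2.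
Proof.
  intros Ha HP1 Hp1 HQ1 Hq1 Hr1 HP2 Hp2 HQ2 Hq2 Hr2 HM a b Hab.
  set (W1 := power_majorant (Rpower P1 alpha) (alpha * p1) (Rpower Q1 alpha) (alpha * q1)).
  set (W2 := power_majorant (Rpower P2 alpha) (alpha * p2) (Rpower Q2 alpha) (alpha * q2)).
  assert (Ex : forall P p Q q, ex_RInt (power_majorant P p Q q) a b).
  { intros. apply ex_RInt_pos; try lra. intros; now apply power_majorant_cont. }
  assert (IW : is_RInt (fun x => Rpower 4 alpha * (W1 x + W2 x)) a b
     (Rpower 4 alpha * (RInt W1 a b + RInt W2 a b))).
  { apply (@is_RInt_scal R_NormedModule), (@is_RInt_plus R_NormedModule);
    apply (@RInt_correct R_CompleteNormedModule), Ex. }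
  apply Rle_trans with (Rpower 4 alpha * (RInt W1 a b + RInt W2 a b)).
  2:{ apply Rmult_le_compat_l; [left; apply Rpower_gt0|].
      apply Rplus_le_compat; apply power_majorant_int; try nra; left; apply Rpower_gt0. }
  refine (is_RInt_le _ _ a b _ _ _
    (@RInt_correct R_CompleteNormedModule _ _ _ (ex_RInt_pos _ a b _ _ _)) IW _); try lra.
  { intros; now apply kern_abs_pow_cont. }
  intros x Hx. assert (Hx0 : 0 < x) by lra.
  destruct (HM x Hx0) as [Hre Him]. cbv zeta in Hre, Him.
  set (A := Rmin (P1 * Rpower x p1) (Q1 * Rpower x (- q1))) in *.
  set (B := Rmin (P2 * Rpower x p2) (Q2 * Rpower x (- q2))) in *.
  assert (HA : 0 < A) by (apply Rmin_glb_lt; apply Rmult_lt_0_compat; trivial; apply Rpower_gt0).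
  assert (HB : 0 < B) by (apply Rmin_glb_lt; apply Rmult_lt_0_compat; trivial; apply Rpower_gt0).
  assert (Hxa : 0 < Rpower x (- / alpha)) by apply Rpower_gt0.
  assert (Hm : sqrt (kern_re alpha H l x ^ 2 + kern_im alpha H l x ^ 2)
               <= (4 * Rpower x (- / alpha)) * Rmax A B).
  { eapply Rle_trans; [apply (sqrt_sum_sq_le _ _ _ Hre Him)|].
    assert (A <= Rmax A B) by apply Rmax_l. assert (B <= Rmax A B) by apply Rmax_r. nra. }
  unfold kern_abs_pow.
  eapply Rle_trans; [apply rpow_le; [lra|exact Hm]|].
  assert (0 <= Rmax A B) by (eapply Rle_trans; [|apply Rmax_l]; lra).
  rewrite rpow_mult by lra.
  rewrite <- Rpower_mult_distr, Rpower_mult by lra.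
  replace (- / alpha * alpha) with (- (1)) by (field; lra).
  rewrite Rpower_Ropp, Rpower_1 by assumption. rewrite Rmult_assoc.
  apply Rmult_le_compat_l; [left; apply Rpower_gt0|].
  assert (HWA : rpow A alpha * / x <= W1 x) by (apply rpow_Rmin_le; assumption).
  assert (HWB : rpow B alpha * / x <= W2 x) by (apply rpow_Rmin_le; assumption).
  assert (Hi := Rinv_0_lt_compat x Hx0).
  assert (0 <= rpow A alpha * / x) by (apply Rmult_le_pos; [apply rpow_ge0|lra]).
  assert (0 <= rpow B alpha * / x) by (apply Rmult_le_pos; [apply rpow_ge0|lra]).
  unfold Rmax. destruct (Rle_dec A B); lra.
Qed.

Lemma Rabs_sin_le (z : R) : Rabs (sin z) <= Rabs z.
Proof.
  assert (P : forall z, 0 <= z -> Rabs (sin z) <= z).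
  { intros y Hy. destruct (Rle_dec y 1).
    - destruct (Req_dec y 0) as [->|]; [rewrite sin_0, Rabs_R0; lra|].
      assert (0 < sin y) by (apply sin_gt_0; [lra|]; assert (HPI := PI2_1); lra).
      rewrite Rabs_pos_eq by lra. left. apply sin_lt_x. lra.
    - assert (HS := SIN_bound y). apply Rabs_le. lra. }
  destruct (Rle_dec 0 z).
  - rewrite (Rabs_pos_eq z) by assumption. now apply P.
  - rewrite <- (Rabs_Ropp z), (Rabs_pos_eq (- z)), <- Rabs_Ropp, <- sin_neg by lra. apply P. lra.
Qed.

Lemma cos_diff_le (a b : R) : Rabs (cos a - cos b) <= Rmin 2 (Rabs (a - b)).
Proof.
  apply Rmin_glb.
  - assert (H1 := COS_bound a). assert (H2 := COS_bound b). apply Rabs_le. lra.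
  - rewrite form2, !Rabs_mult, (Rabs_left (-2)) by lra.
    assert (H1 := Rabs_sin_le ((a - b) / 2)).
    assert (H2 : Rabs (sin ((a + b) / 2)) <= 1) by (apply Rabs_le; assert (H := SIN_bound ((a + b) / 2)); lra).
    assert (H3 := Rabs_pos (sin ((a - b) / 2))). assert (H4 := Rabs_pos (sin ((a + b) / 2))).
    unfold Rdiv at 2 in H1. rewrite Rabs_mult, (Rabs_pos_eq (/ 2)) in H1 by lra. nra.
Qed.

Lemma sin_diff_le (a b : R) : Rabs (sin a - sin b) <= Rmin 2 (Rabs (a - b)).
Proof.
  rewrite <- (cos_shift a), <- (cos_shift b).
  replace (Rabs (a - b)) with (Rabs ((PI / 2 - a) - (PI / 2 - b))); [apply cos_diff_le|].
  rewrite <- (Rabs_Ropp (a - b)). f_equal. ring.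
Qed.

Lemma inv_kernel_weight (alpha h x : R) : 0 < x ->
  / Rpower (Rabs x) (/ alpha + h) = Rpower x (- / alpha) * Rpower x (- h).
Proof.
  intros Hx. rewrite Rabs_pos_eq, <- Rpower_Ropp, <- Rpower_plus by lra. f_equal. ring.
Qed.

(** For x <= 1 the branch a x gives the exponent 1 - h, which is at least 1 - hhi and -hlo. For x >
    1 the branch 2 gives -h, which is at most both. *)
Lemma trig_weight_le (a h hlo hhi x : R) : 0 < x -> 0 <= a -> hlo <= h <= hhi -> hhi < 1 -> 0 < hlo ->
  Rmin 2 (a * x) * Rpower x (- h) <= (2 + a) * Rmin (Rpower x (1 - hhi)) (Rpower x (- hlo)).
Proof.
  intros Hx Ha Hh H1 H0.
  assert (G := Rpower_gt0 x (- h)).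
  destruct (Rle_dec x 1).
  - apply Rle_trans with (a * Rpower x (1 - h)).
    + replace (1 - h) with (1 + - h) by ring. rewrite Rpower_plus, Rpower_1, <- Rmult_assoc by assumption.
      apply Rmult_le_compat_r; [lra|apply Rmin_r].
    + assert (0 < Rpower x (1 - h)) by apply Rpower_gt0.
      apply Rmult_le_compat; try lra.
      apply Rmin_glb; apply Rpower_le_exp_le1; lra.
  - apply Rmult_le_compat; try lra.
    + apply Rmin_glb; nra.
    + apply Rle_trans with 2; [apply Rmin_l|lra].
    + apply Rmin_glb; apply Rpower_le_exp_ge1; lra.
Qed.

Lemma Rmin_mult_l (c u v : R) : 0 < c -> Rmin (c * u) (c * v) = c * Rmin u v.
Proof.
  intros Hc. unfold Rmin. destruct (Rle_dec (c * u) (c * v)), (Rle_dec u v); nra.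
Qed.

Lemma kern_growth (alpha : R) (H : R -> R) (hlo hhi : R) (l : list (R * R)) :
  0 < hlo -> hhi < 1 -> (forall t, 0 <= t -> hlo <= H t <= hhi) ->
  (forall p, In p l -> 0 <= snd p) ->
  exists C, 0 < C /\ forall x, 0 < x ->
    let M := C * Rmin (Rpower x (1 - hhi)) (Rpower x (- hlo)) in
    Rabs (kern_re alpha H l x) <= Rpower x (- / alpha) * M /\
    Rabs (kern_im alpha H l x) <= Rpower x (- / alpha) * M.
Proof.
  intros H0 H1 HH. induction l as [|[c t] l IH]; intros Hl.
  - exists 1. split; [lra|]. intros x Hx. simpl. rewrite Rabs_R0.
    assert (0 <= Rpower x (- / alpha) * (1 * Rmin (Rpower x (1 - hhi)) (Rpower x (- hlo)))).
    { apply Rmult_le_pos; [left; apply Rpower_gt0|]. rewrite Rmult_1_l.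
      apply Rmin_glb; left; apply Rpower_gt0. }
    split; assumption.
  - destruct IH as (C & HC & IH); [intros p Hp; apply Hl; now right|].
    assert (Ht : 0 <= t) by (apply (Hl (c, t)); now left).
    assert (Hct := Rabs_pos c).
    exists (C + Rabs c * (2 + t)). split; [nra|]. intros x Hx.
    destruct (IH x Hx) as [IH1 IH2]. cbv zeta in IH1, IH2 |- *.
    assert (Wt := trig_weight_le t (H t) hlo hhi x Hx Ht (HH t Ht) H1 H0).
    set (m := Rmin (Rpower x (1 - hhi)) (Rpower x (- hlo))) in *.
    assert (Ga := Rpower_gt0 x (- / alpha)). assert (Gh := Rpower_gt0 x (- H t)).
    set (ga := Rpower x (- / alpha)) in *. set (gh := Rpower x (- H t)) in *.
    assert (T : forall z, Rabs z <= Rmin 2 (t * x) ->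
       Rabs (c * z / Rpower (Rabs x) (/ alpha + H t)) <= ga * (Rabs c * (2 + t) * m)).
    { intros z Hz. unfold Rdiv. rewrite inv_kernel_weight by assumption. fold ga gh.
      rewrite !Rabs_mult, (Rabs_pos_eq ga), (Rabs_pos_eq gh) by lra.
      assert (Rabs z * gh <= (2 + t) * m).
      { eapply Rle_trans; [|exact Wt]. apply Rmult_le_compat_r; lra. }
      replace (Rabs c * Rabs z * (ga * gh)) with (ga * (Rabs c * (Rabs z * gh))) by ring.
      rewrite Rmult_assoc. apply Rmult_le_compat_l; [lra|]. now apply Rmult_le_compat_l. }
    assert (Htx : Rabs (t * x - 0) = t * x) by (rewrite Rminus_0_r; apply Rabs_pos_eq; nra).
    replace (ga * ((C + Rabs c * (2 + t)) * m)) with (ga * (Rabs c * (2 + t) * m) + ga * (C * m)) by ring.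
    unfold kern_re, kern_im. cbn [fold_right fst snd].
    split; (eapply Rle_trans; [apply Rabs_triang|]; apply Rplus_le_compat; [|assumption]).
    + apply T. assert (E := cos_diff_le (t * x) 0). now rewrite cos_0, Htx in E.
    + apply T. assert (E := sin_diff_le (t * x) 0). now rewrite sin_0, Rminus_0_r, Htx in E.
Qed.

(** Integrability of every kernel, which makes [Lalpha_pow] a genuine supremum in the lower
    bounds. *)
Lemma kern_int_bounded (alpha : R) (H : R -> R) (hlo hhi : R) (l : list (R * R)) :
  0 < alpha -> 0 < hlo -> hhi < 1 -> (forall t, 0 <= t -> hlo <= H t <= hhi) ->
  (forall p, In p l -> 0 <= snd p) ->
  exists K, forall a b, 0 < a < b -> RInt (kern_abs_pow alpha H l) a b <= K.
Proof.
  intros Ha H0 H1 HH Hl.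
  destruct (kern_growth alpha H hlo hhi l H0 H1 HH Hl) as (C & HC & HB).
  (* One majorant suffices, so it fills both slots; the splitting point 1 is arbitrary. *)
  exists (kern_bound_value alpha C (1 - hhi) C hlo 1 C (1 - hhi) C hlo 1).
  apply kern_int_bound; try lra. intros x Hx. cbv zeta.
  destruct (HB x Hx) as [B1 B2]. cbv zeta in B1, B2.
  assert (E : Rmin (C * Rpower x (1 - hhi)) (C * Rpower x (- hlo))
     = C * Rmin (Rpower x (1 - hhi)) (Rpower x (- hlo))) by now apply Rmin_mult_l.
  rewrite E. assert (0 < Rmin (Rpower x (1 - hhi)) (Rpower x (- hlo)))
    by (apply Rmin_glb_lt; apply Rpower_gt0).
  assert (G := Rpower_gt0 x (- / alpha)).
  assert (0 < C * Rmin (Rpower x (1 - hhi)) (Rpower x (- hlo))) by nra.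
  split; (eapply Rle_trans; [eassumption|]; apply Rmult_le_compat_l; lra).
Qed.

Lemma exp_diff_le (a b : R) : Rabs (exp a - exp b) <= Rabs (a - b) * Rmax (exp a) (exp b).
Proof.
  assert (P : forall a b, a <= b -> exp b - exp a <= (b - a) * exp b).
  { intros x y Hxy. assert (E := exp_ineq1_le (x - y)).
    assert (G := exp_pos y). replace (exp x) with (exp (x - y) * exp y).
    - nra.
    - rewrite <- exp_plus. f_equal. ring. }
  assert (M : forall x y, x <= y -> exp x <= exp y).
  { intros x y [Hl| ->]; [left; now apply exp_increasing|apply Rle_refl]. }
  destruct (Rle_dec a b) as [Hab|Hab].
  - rewrite Rmax_right, !(Rabs_minus_sym a), Rabs_minus_sym by now apply M.
    rewrite (Rabs_pos_eq (b - a)), Rabs_pos_eq by (try (specialize (M _ _ Hab)); lra).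
    now apply P.
  - assert (Hba : b <= a) by lra.
    rewrite Rmax_left by now apply M.
    rewrite (Rabs_pos_eq (a - b)), Rabs_pos_eq by (try (specialize (M _ _ Hba)); lra).
    now apply P.
Qed.

(** A mean value estimate in the exponent costs a factor |ln x|. It is absorbed by giving up half of
    the available decay, whence the halves in [p] and [q]. *)
Lemma Rpower_diff_le (x h1 h2 hlo hhi T : R) :
  0 < x -> 0 < hlo -> hhi < 1 -> hlo <= h1 <= hhi -> hlo <= h2 <= hhi -> 0 < T ->
  let p := (1 - hhi) / 2 in let q := hlo / 2 in
  Rmin 2 (T * x) * Rabs (Rpower x (- h1) - Rpower x (- h2)) <=
  Rabs (h1 - h2) * (T / p + 2 / q) * Rmin (Rpower x p) (Rpower x (- q)).
Proof.
  intros Hx H0 H1 Hh1 Hh2 HT p q.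
  assert (Hp : 0 < p) by (unfold p; lra). assert (Hq : 0 < q) by (unfold q; lra).
  assert (E := exp_diff_le (- h1 * ln x) (- h2 * ln x)).
  fold (Rpower x (- h1)) in E. fold (Rpower x (- h2)) in E.
  replace (- h1 * ln x - - h2 * ln x) with ((h2 - h1) * ln x) in E by ring.
  rewrite Rabs_mult, (Rabs_minus_sym h2) in E.
  assert (D := Rabs_pos (h1 - h2)). assert (L := Rabs_pos (ln x)).
  assert (HTp : 0 < T / p) by (apply Rdiv_lt_0_compat; lra).
  assert (H2q : 0 < 2 / q) by (apply Rdiv_lt_0_compat; lra).
  assert (Ln : forall e, 0 < e -> Rabs (ln x) <= exp (e * Rabs (ln x)) * / e).
  { intros e He. assert (X := exp_ineq1_le (e * Rabs (ln x))).
    apply (Rmult_le_reg_l e); [assumption|].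
    replace (e * (exp (e * Rabs (ln x)) * / e)) with (exp (e * Rabs (ln x))) by (field; lra). lra. }
  (* Common end of the cases x <= 1 and x > 1: [F] is the branch of the minimum in use and [W] the
     power that remains. *)
  assert (Fin : forall F c W, 0 <= F -> 0 <= W -> Rmin 2 (T * x) <= F ->
      F * (Rabs (ln x) * Rmax (Rpower x (- h1)) (Rpower x (- h2))) <= c * W ->
      c <= T / p + 2 / q -> W <= Rmin (Rpower x p) (Rpower x (- q)) ->
      Rmin 2 (T * x) * Rabs (Rpower x (- h1) - Rpower x (- h2)) <=
      Rabs (h1 - h2) * (T / p + 2 / q) * Rmin (Rpower x p) (Rpower x (- q))).
  { intros F c W HF HW HFm Hc1 Hc2 HWm.
    apply Rle_trans with (F * (Rabs (h1 - h2) * Rabs (ln x) * Rmax (Rpower x (- h1)) (Rpower x (- h2)))).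
    - apply Rmult_le_compat; try assumption; [|apply Rabs_pos].
      apply Rmin_glb; nra.
    - replace (F * (Rabs (h1 - h2) * Rabs (ln x) * Rmax (Rpower x (- h1)) (Rpower x (- h2))))
        with (Rabs (h1 - h2) * (F * (Rabs (ln x) * Rmax (Rpower x (- h1)) (Rpower x (- h2))))) by ring.
      rewrite Rmult_assoc. apply Rmult_le_compat_l; [assumption|].
      apply Rle_trans with (c * W); [assumption|]. nra. }
  assert (G1 := Rpower_gt0 x (- h1)). assert (G2 := Rpower_gt0 x (- h2)).
  destruct (Rle_dec x 1) as [Hx1|Hx1].
  - assert (HL : Rabs (ln x) = - ln x).
    { assert (ln x <= 0) by (rewrite <- ln_1; apply ln_le; lra). apply Rabs_left1; assumption. }
    apply (Fin (T * x) (T / p) (Rpower x p)).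
    + nra.
    + left; apply Rpower_gt0.
    + apply Rmin_r.
    + assert (M : Rmax (Rpower x (- h1)) (Rpower x (- h2)) <= Rpower x (- hhi))
        by (apply Rmax_lub; apply Rpower_le_exp_le1; lra).
      assert (Lp := Ln p Hp). rewrite HL in Lp at 2.
      replace (exp (p * - ln x)) with (Rpower x (- p)) in Lp by (unfold Rpower; f_equal; ring).
      apply Rle_trans with (T * x * (Rpower x (- p) * / p * Rpower x (- hhi))).
      * apply Rmult_le_compat_l; [nra|]. apply Rmult_le_compat; try assumption.
        eapply Rle_trans; [|apply Rmax_l]; lra.
      * replace (Rpower x p) with (x * (Rpower x (- p) * Rpower x (- hhi))).
        -- right. field. lra.
        -- rewrite <- (Rpower_1 x) at 1 by assumption. rewrite <- !Rpower_plus. f_equal. unfold p. field.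
    + lra.
    + apply Rmin_glb; apply Rpower_le_exp_le1; lra.
  - assert (HL : Rabs (ln x) = ln x).
    { assert (0 <= ln x) by (rewrite <- ln_1; apply ln_le; lra). now apply Rabs_pos_eq. }
    apply (Fin 2 (2 / q) (Rpower x (- q))).
    + lra.
    + left; apply Rpower_gt0.
    + apply Rmin_l.
    + assert (M : Rmax (Rpower x (- h1)) (Rpower x (- h2)) <= Rpower x (- hlo))
        by (apply Rmax_lub; apply Rpower_le_exp_ge1; lra).
      assert (Lq := Ln q Hq). rewrite HL in Lq at 2.
      fold (Rpower x q) in Lq.
      apply Rle_trans with (2 * (Rpower x q * / q * Rpower x (- hlo))).
      * apply Rmult_le_compat_l; [lra|]. apply Rmult_le_compat; try assumption.
        eapply Rle_trans; [|apply Rmax_l]; lra.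
      * replace (Rpower x (- q)) with (Rpower x q * Rpower x (- hlo)).
        -- right. field. lra.
        -- rewrite <- !Rpower_plus. f_equal. unfold q. field.
    + lra.
    + apply Rmin_glb; apply Rpower_le_exp_ge1; lra.
Qed.

(** * Norms of increments and of prediction errors *)

Lemma Rpower_Rinv (x a : R) : 0 < x -> Rpower (/ x) a = Rpower x (- a).
Proof. intros Hx. unfold Rpower. rewrite ln_Rinv by assumption. f_equal. ring. Qed.

(** Up to x^(-1/alpha) the kernel is x^(-H t) (e^{itx} - e^{isx}) + (e^{isx} - 1) (x^(-H t) - x^(-H
    s)). The first term yields d^(alpha H t) by scaling; the second yields d^(alpha gamma), which is
    no larger since d <= 1 and H t <= hhi < gamma. *)
Lemma increment_upper (alpha : R) (H : R -> R) (hlo hhi C gamma T : R) :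
  0 < alpha -> 0 < hlo -> hhi < 1 -> (forall t, 0 <= t -> hlo <= H t <= hhi) ->
  0 < C -> hhi < gamma ->
  (forall t s, 0 <= t -> 0 <= s -> Rabs (H t - H s) <= C * rpow (Rabs (t - s)) gamma) ->
  0 < T ->
  exists K, 0 < K /\ forall s t, 0 <= s < t -> t <= T -> t - s <= 1 ->
    Lalpha_pow alpha H ((1, t) :: (-1, s) :: nil) <= K * Rpower (t - s) (alpha * H t).
Proof.
  intros Ha H0 H1 HH HC Hg Hol HT.
  assert (Hhh : hlo <= hhi) by (specialize (HH 0 (Rle_refl 0)); lra).
  set (p := (1 - hhi) / 2). set (q := hlo / 2).
  assert (Hp : 0 < p) by (unfold p; lra). assert (Hq : 0 < q) by (unfold q; lra).
  set (K2 := (T / p + 2 / q) * C).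
  assert (HK2 : 0 < K2).
  { apply Rmult_lt_0_compat; [|assumption].
    apply Rplus_lt_0_compat; apply Rdiv_lt_0_compat; lra. }
  set (K := Rpower 4 alpha * ((/ (alpha * (1 - hhi)) + Rpower 2 alpha * / (alpha * hlo))
     + Rpower K2 alpha * (/ (alpha * p) + / (alpha * q)))).
  assert (V1 : 0 < / (alpha * (1 - hhi))) by (apply Rinv_0_lt_compat; nra).
  assert (V2 : 0 < / (alpha * hlo)) by (apply Rinv_0_lt_compat; nra).
  assert (V3 : 0 < / (alpha * p)) by (apply Rinv_0_lt_compat; nra).
  assert (V4 : 0 < / (alpha * q)) by (apply Rinv_0_lt_compat; nra).
  assert (G4 := Rpower_gt0 4 alpha). assert (G2 := Rpower_gt0 2 alpha).
  assert (GK := Rpower_gt0 K2 alpha).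
  assert (HK : 0 < K).
  { unfold K. apply Rmult_lt_0_compat; [assumption|].
    apply Rplus_lt_0_compat; [nra|]. apply Rmult_lt_0_compat; [assumption|lra]. }
  exists (2 * K). split; [lra|].
  intros s t Hst HtT Hd.
  set (d := t - s). assert (Hd0 : 0 < d) by (unfold d; lra). fold d in Hd.
  assert (Ht := HH t ltac:(lra)). assert (Hs := HH s ltac:(lra)).
  assert (GX := Rpower_gt0 d (alpha * H t)).
  rewrite (Rmult_assoc 2). apply Lalpha_pow_le; [assumption|nra|].
  intros a b Hab.
  set (dg := Rpower d gamma). assert (Gdg : 0 < dg) by apply Rpower_gt0.
  assert (HKd : 0 < K2 * dg) by nra.
  (* The first majorant is x^(-H t) min(d x, 2), split at the scale 1/d, where both branches give
     d^(alpha H t). The second, for the variation of H, carries its smallness in the coefficient and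
     is split at 1. *)
  apply Rle_trans with
    (kern_bound_value alpha d (1 - H t) 2 (H t) (/ d) (K2 * dg) p (K2 * dg) q 1).
  - apply kern_int_bound; try lra; [now apply Rinv_0_lt_compat|].
    intros x Hx. cbv zeta.
    assert (HD : Rabs (H t - H s) <= C * dg).
    { specialize (Hol t s ltac:(lra) ltac:(lra)).
      rewrite (Rabs_pos_eq (t - s)), rpow_pos in Hol by lra. exact Hol. }
    assert (PD := Rpower_diff_le x (H t) (H s) hlo hhi T Hx H0 H1 Ht Hs HT).
    cbv zeta in PD. fold p q in PD.
    rewrite Rmin_mult_l by assumption.
    set (m := Rmin (Rpower x p) (Rpower x (- q))) in *.
    assert (Hm : 0 < m) by (apply Rmin_glb_lt; apply Rpower_gt0).
    assert (PD' : Rmin 2 (T * x) * Rabs (Rpower x (- H t) - Rpower x (- H s)) <= K2 * dg * m).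
    { eapply Rle_trans; [exact PD|]. apply Rmult_le_compat_r; [lra|].
      replace (K2 * dg) with (C * dg * (T / p + 2 / q)) by (unfold K2; ring).
      apply Rmult_le_compat_r; [|assumption].
      left. apply Rplus_lt_0_compat; apply Rdiv_lt_0_compat; lra. }
    assert (Gt := Rpower_gt0 x (- H t)).
    assert (EA : Rmin (d * Rpower x (1 - H t)) (2 * Rpower x (- H t)) =
                 Rpower x (- H t) * Rmin 2 (d * x)).
    { replace (1 - H t) with (1 + - H t) by ring. rewrite Rpower_plus, Rpower_1 by assumption.
      rewrite <- Rmin_mult_l, Rmin_comm by assumption. f_equal; ring. }
    rewrite EA.
    assert (Ga := Rpower_gt0 x (- / alpha)).
    assert (Ed : Rabs (t * x - s * x) = d * x).
    { replace (t * x - s * x) with (d * x) by (unfold d; ring). apply Rabs_pos_eq. nra. }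
    assert (Fin : forall z1 z2, Rabs (z1 - z2) <= Rmin 2 (d * x) -> Rabs z2 <= Rmin 2 (T * x) ->
      Rabs (1 * z1 / Rpower (Rabs x) (/ alpha + H t)
            + (-1 * z2 / Rpower (Rabs x) (/ alpha + H s) + 0)) <=
      Rpower x (- / alpha) * (Rpower x (- H t) * Rmin 2 (d * x) + K2 * dg * m)).
    { intros z1 z2 Hz Hz2. unfold Rdiv. rewrite !inv_kernel_weight by assumption.
      replace (1 * z1 * (Rpower x (- / alpha) * Rpower x (- H t))
        + (-1 * z2 * (Rpower x (- / alpha) * Rpower x (- H s)) + 0)) with
        (Rpower x (- / alpha) * (Rpower x (- H t) * (z1 - z2)
           + z2 * (Rpower x (- H t) - Rpower x (- H s)))) by ring.
      rewrite Rabs_mult, (Rabs_pos_eq (Rpower x (- / alpha))) by lra.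
      apply Rmult_le_compat_l; [lra|].
      eapply Rle_trans; [apply Rabs_triang|]. apply Rplus_le_compat.
      - rewrite Rabs_mult, Rabs_pos_eq by lra. apply Rmult_le_compat_l; lra.
      - eapply Rle_trans; [|exact PD']. rewrite Rabs_mult.
        apply Rmult_le_compat_r; [apply Rabs_pos|assumption]. }
    assert (HsT : Rmin 2 (s * x) <= Rmin 2 (T * x)).
    { apply Rle_min_compat_l. apply Rmult_le_compat_r; lra. }
    assert (Hsx : Rabs (s * x - 0) = s * x) by (rewrite Rminus_0_r; apply Rabs_pos_eq; nra).
    unfold kern_re, kern_im. cbn [fold_right fst snd]. split; apply Fin.
    + replace (cos (t * x) - 1 - (cos (s * x) - 1)) with (cos (t * x) - cos (s * x)) by ring.
      rewrite <- Ed. apply cos_diff_le.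
    + assert (E := cos_diff_le (s * x) 0). rewrite cos_0, Hsx in E. lra.
    + rewrite <- Ed. apply sin_diff_le.
    + assert (E := sin_diff_le (s * x) 0). rewrite sin_0, Rminus_0_r, Hsx in E. lra.
  - set (X := Rpower d (alpha * H t)) in *.
    assert (S1 : Rpower d alpha * Rpower (/ d) (alpha * (1 - H t)) / (alpha * (1 - H t))
       <= X * / (alpha * (1 - hhi))).
    { rewrite Rpower_Rinv, <- Rpower_plus by assumption.
      replace (alpha + - (alpha * (1 - H t))) with (alpha * H t) by ring. fold X.
      apply Rmult_le_compat_l; [lra|]. apply Rinv_le_contravar; [nra|].
      apply Rmult_le_compat_l; lra. }
    assert (S2 : Rpower 2 alpha * Rpower (/ d) (- (alpha * H t)) / (alpha * H t)
       <= X * (Rpower 2 alpha * / (alpha * hlo))).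
    { rewrite Rpower_Rinv by assumption.
      rewrite Ropp_involutive. fold X.
      replace (Rpower 2 alpha * X / (alpha * H t)) with
        (X * (Rpower 2 alpha * / (alpha * H t))) by (unfold Rdiv; ring).
      apply Rmult_le_compat_l; [lra|]. apply Rmult_le_compat_l; [lra|].
      apply Rinv_le_contravar; [nra|]. apply Rmult_le_compat_l; lra. }
    assert (S3 : Rpower (K2 * dg) alpha <= Rpower K2 alpha * X).
    { rewrite <- Rpower_mult_distr by assumption. apply Rmult_le_compat_l; [lra|].
      unfold dg, X. rewrite Rpower_mult. apply Rpower_le_exp_le1; [lra|].
      rewrite (Rmult_comm gamma). apply Rmult_le_compat_l; lra. }
    assert (O1 : forall e, Rpower 1 e = 1)
      by (intros e; unfold Rpower; rewrite ln_1, Rmult_0_r; apply exp_0).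
    unfold kern_bound_value, K. rewrite !O1, !Rmult_1_r.
    rewrite (Rmult_assoc (Rpower 4 alpha)). apply Rmult_le_compat_l; [lra|].
    rewrite Rmult_plus_distr_r. apply Rplus_le_compat; [lra|].
    unfold Rdiv. rewrite <- Rmult_plus_distr_l.
    replace (Rpower K2 alpha * (/ (alpha * p) + / (alpha * q)) * X) with
      (Rpower K2 alpha * X * (/ (alpha * p) + / (alpha * q))) by ring.
    apply Rmult_le_compat_r; lra.
Qed.

(* Multiplying the kernel by |x|^(1/alpha + H t) e^{-itx} with x = y/d turns
   c (e^{isx} - 1) / |x|^(1/alpha + H s) into the conjugates of these two terms. *)
Definition rescaled_terms (H : R -> R) (d t : R) (p : R * R) : list (R * (R * R)) :=
  let c := fst p * Rpower d (H (snd p) - H t) in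
  (c, ((t - snd p) / d, H t - H (snd p))) :: (- c, (t / d, H t - H (snd p))) :: nil.

(** The left sides are the real part and minus the imaginary part of x^(1/alpha + H t) e^{-itx}
    g(x). The form of [x] is that of the affine substitution [is_RInt_comp_lin]. *)
Lemma kern_rescaled alpha (H : R -> R) (d t : R) l y : 0 < d -> 0 < y ->
  let x := / d * y + 0 in
  Rpower x (/ alpha + H t) *
    (kern_re alpha H l x * cos (t * x) + kern_im alpha H l x * sin (t * x)) =
    trig_re (flat_map (rescaled_terms H d t) l) y /\
  Rpower x (/ alpha + H t) *
    (kern_re alpha H l x * sin (t * x) - kern_im alpha H l x * cos (t * x)) =
    trig_im (flat_map (rescaled_terms H d t) l) y.
Proof.
  intros Hd Hy x.
  assert (Hx : 0 < x).
  { assert (0 < / d) by now apply Rinv_0_lt_compat. unfold x. nra. }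
  induction l as [|[v s] l [IH1 IH2]]; [simpl; split; ring|].
  unfold kern_re, kern_im. cbn [fold_right fst snd].
  fold (kern_re alpha H l x). fold (kern_im alpha H l x).
  cbn [flat_map rescaled_terms app trig_re trig_im fold_right fst snd].
  fold (trig_re (flat_map (rescaled_terms H d t) l) y).
  fold (trig_im (flat_map (rescaled_terms H d t) l) y).
  rewrite <- IH1, <- IH2.
  (* The power of d does not depend on y and joins the arbitrary coefficient, so it never has to be
     bounded. *)
  assert (W : Rpower x (/ alpha + H t) * / Rpower (Rabs x) (/ alpha + H s) =
     Rpower d (H s - H t) * Rpower y (H t - H s)).
  { rewrite inv_kernel_weight, <- !Rpower_plus by assumption.
    replace (/ alpha + H t + (- / alpha + - H s)) with (H t - H s) by ring.
    unfold x. rewrite Rplus_0_r, <- Rpower_mult_distr, Rpower_Rinv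
      by (try assumption; now apply Rinv_0_lt_compat).
    f_equal. f_equal. ring. }
  replace ((t - s) / d * y) with (t * x - s * x) by (unfold x; field; lra).
  replace (t / d * y) with (t * x) by (unfold x; field; lra).
  unfold Rdiv. rewrite cos_minus, sin_minus.
  set (w := / Rpower (Rabs x) (/ alpha + H s)) in *.
  set (P := Rpower x (/ alpha + H t)) in *.
  assert (W' : forall z, v * Rpower d (H s - H t) * (Rpower y (H t - H s) * z) = v * (P * w) * z)
    by (intros z; rewrite W; ring).
  assert (W'' : forall z, - (v * Rpower d (H s - H t)) * (Rpower y (H t - H s) * z) = - (v * (P * w) * z))
    by (intros z; rewrite W; ring).
  rewrite !W', !W''. assert (CS := sin2_cos2 (t * x)). unfold Rsqr in CS.
  split; ring.
Qed.

(* Replaces Hoelder's inequality: z <= r + r^(1-alpha) z^alpha. *)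
Lemma rpow_ge_linear (alpha r z : R) : 1 < alpha -> 0 < r -> 0 <= z ->
  Rpower r (alpha - 1) * (z - r) <= rpow z alpha.
Proof.
  intros Ha Hr Hz. assert (G := Rpower_gt0 r (alpha - 1)).
  destruct (Rle_dec z r).
  - apply Rle_trans with 0; [nra|apply rpow_ge0].
  - rewrite rpow_pos by lra. replace alpha with (alpha - 1 + 1) at 2 by ring.
    rewrite Rpower_plus, Rpower_1 by lra.
    assert (Rpower r (alpha - 1) <= Rpower z (alpha - 1)) by (apply Rle_Rpower_l; lra).
    apply Rmult_le_compat; lra.
Qed.

(** The constant depends neither on the coefficients in [l] nor on the points, only on the gap d and
    the number m. The cases m = 0, 1 and n - 1 serve (L1), (L2) and (L3). *)
Lemma kern_lower (alpha : R) (H : R -> R) (hlo hhi : R) (m : nat) :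
  1 < alpha -> 0 < hlo -> hhi < 1 -> (forall t, 0 <= t -> hlo <= H t <= hhi) ->
  exists c, 0 < c /\ forall d t l, length l = m -> 0 < d <= t ->
    (forall p, In p l -> 0 <= snd p <= t - d) ->
    c * Rpower d (alpha * H t) <= Lalpha_pow alpha H ((1, t) :: l).
Proof.
  intros Ha H0 H1 HH.
  (* Two terms for each entry of [l], and one from X(t) itself: e^{-itx} (e^{itx} - 1) = 1 -
     e^{-itx}, whose 1 is the constant term of the bound. *)
  destruct (trig_lower_bound (S (2 * m))) as (c0 & Hc0 & Hlow).
  (* Chosen so that the integral of [G - r] over [1,2] is still at least r. *)
  set (r := c0 / 2). assert (Hr : 0 < r) by (unfold r; lra).
  (* A lower bound for y^(-(1 + alpha H t)) on [1,2], because H t < 1. *)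
  set (k := Rpower 2 (- (1 + alpha))). assert (Hk : 0 < k) by apply Rpower_gt0.
  assert (Gr := Rpower_gt0 r alpha).
  exists (2 * (k * Rpower r alpha)). split; [nra|].
  intros d t l Hlen Hd Hl.
  assert (Hdi : 0 < / d) by (apply Rinv_0_lt_compat; lra).
  assert (Ht := HH t ltac:(lra)).
  assert (Hpos : forall p, In p ((1, t) :: l) -> 0 <= snd p).
  { intros p [<-|Hp]; [simpl; lra|]. apply Hl in Hp. lra. }
  destruct (kern_int_bounded alpha H hlo hhi ((1, t) :: l)) as [K HK]; auto; [lra|].
  set (h := kern_abs_pow alpha H ((1, t) :: l)) in *.
  set (tl := (-1, (t / d, 0)) :: flat_map (rescaled_terms H d t) l).
  assert (Ltl : length tl = S (2 * m)).
  { unfold tl. cbn [length]. f_equal. rewrite <- Hlen. clear.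
    induction l as [|p l IH]; [reflexivity|]. cbn [flat_map rescaled_terms app length].
    rewrite IH. lia. }
  assert (Atl : forall q, In q (map snd tl) -> admissible q).
  { intros q Hq. apply in_map_iff in Hq. destruct Hq as (z & <- & Hz).
    assert (D : forall e, d <= e -> 1 <= Rabs (e / d)).
    { intros e He. assert (1 <= e / d) by (apply (Rmult_le_reg_r d); [lra|]; unfold Rdiv; rewrite Rmult_assoc, Rinv_l by lra; lra).
      rewrite Rabs_pos_eq; lra. }
    destruct Hz as [<-|Hz].
    - split; cbn [fst snd]; [apply D; lra|rewrite Rabs_R0; lra].
    - apply in_flat_map in Hz. destruct Hz as (p & Hp & Hz).
      assert (Hsp := Hl p Hp). assert (HHs := HH (snd p) ltac:(lra)).
      destruct Hz as [<-|[<-|[]]]; split; cbn [fst snd]; try (apply D; lra);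
        apply Rabs_le; lra. }
  specialize (Hlow tl Ltl Atl).
  set (G := fun y => sqrt ((1 + trig_re tl y) ^ 2 + trig_im tl y ^ 2)) in *.
  assert (IG : is_RInt G 1 2 (RInt G 1 2)).
  { apply (@RInt_correct R_CompleteNormedModule), ex_RInt_pos; try lra.
    intros; now apply trig_mod_cont. }
  set (X := Rpower d (alpha * H t)). assert (GX : 0 < X) by apply Rpower_gt0.
  set (A := k * X * Rpower r (alpha - 1)).
  assert (Gr1 := Rpower_gt0 r (alpha - 1)).
  assert (HA : 0 < A) by (unfold A; apply Rmult_lt_0_compat; [nra|assumption]).
  assert (HG : forall y, 1 <= y <= 2 -> A * (G y - r) <= / d * h (/ d * y + 0)).
  { intros y Hy.
    assert (Hd' : 0 < d) by lra. assert (Hy' : 0 < y) by lra.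
    destruct (kern_rescaled alpha H d t l y Hd' Hy') as [E1 E2]. cbv zeta in E1, E2.
    set (x := / d * y + 0) in *.
    assert (Hx : 0 < x) by (unfold x; nra).
    set (W := Rpower x (/ alpha + H t)) in *.
    assert (HW : 0 < W) by apply Rpower_gt0.
    assert (EG : G y = W * sqrt (kern_re alpha H ((1, t) :: l) x ^ 2
                               + kern_im alpha H ((1, t) :: l) x ^ 2)).
    { unfold G. rewrite <- (sqrt_Rsqr W) at 1 by lra. rewrite <- sqrt_mult_alt by apply Rle_0_sqr.
      f_equal. unfold tl. cbn [trig_re trig_im fold_right fst snd].
      fold (trig_re (flat_map (rescaled_terms H d t) l) y).
      fold (trig_im (flat_map (rescaled_terms H d t) l) y).
      rewrite <- E1, <- E2. rewrite Rpower_O by assumption.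
      replace (t / d * y) with (t * x) by (unfold x; field; lra).
      cbn [kern_re kern_im fold_right fst snd].
      fold (kern_re alpha H l x). fold (kern_im alpha H l x).
      rewrite (Rabs_pos_eq x) by lra. fold W.
      assert (CS := sin2_cos2 (t * x)). unfold Rsqr in CS |- *.
      set (c := cos (t * x)) in *. set (s := sin (t * x)) in *.
      set (u := kern_re alpha H l x). set (v := kern_im alpha H l x).
      (* Here a + i b is [W] times the kernel; the rotation by e^{-itx} preserves its modulus. *)
      set (a := W * u + c - 1). set (b := W * v + s).
      transitivity ((a * c + b * s) ^ 2 + (a * s - b * c) ^ 2).
      - f_equal; [|f_equal; unfold a, b; ring].
        f_equal. transitivity (s * s + c * c - c + W * (u * c + v * s)).
        + rewrite CS. ring.
        + unfold a, b. ring.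
      - transitivity ((a ^ 2 + b ^ 2) * (s * s + c * c)); [ring|].
        rewrite CS. unfold a, b. field. lra. }
    assert (EM : h x = Rpower x (- (1 + alpha * H t)) * rpow (G y) alpha).
    { unfold h, kern_abs_pow.
      replace (sqrt (kern_re alpha H ((1, t) :: l) x ^ 2
                               + kern_im alpha H ((1, t) :: l) x ^ 2)) with
        (Rpower x (- (/ alpha + H t)) * G y).
      - rewrite rpow_mult; [|apply Rpower_gt0|apply sqrt_pos].
        rewrite Rpower_mult. do 2 f_equal. field. lra.
      - rewrite EG, Rpower_Ropp. fold W. field. lra. }
    rewrite EM.
    assert (EX : / d * Rpower x (- (1 + alpha * H t)) = X * Rpower y (- (1 + alpha * H t))).
    { unfold x. rewrite Rplus_0_r, <- Rpower_mult_distr, Rpower_Rinv by assumption.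
      rewrite Ropp_involutive, Rpower_plus, Rpower_1 by assumption. fold X. field. lra. }
    rewrite <- Rmult_assoc, EX.
    assert (Hky : k <= Rpower y (- (1 + alpha * H t))).
    { apply Rle_trans with (Rpower 2 (- (1 + alpha * H t))).
      - apply Rpower_le_exp_ge1; [lra|nra].
      - rewrite !Rpower_Ropp. apply Rinv_le_contravar; [apply Rpower_gt0|].
        apply Rle_Rpower_l; [nra|lra]. }
    assert (HGy := rpow_ge_linear alpha r (G y) Ha Hr (sqrt_pos _)).
    assert (Hrg := rpow_ge0 (G y) alpha).
    unfold A. apply Rle_trans with (k * X * rpow (G y) alpha).
    - rewrite Rmult_assoc. apply Rmult_le_compat_l; [nra|assumption].
    - apply Rmult_le_compat_r; [assumption|]. nra. }
  assert (I1 : is_RInt (fun y => A * (G y - r)) 1 2 (A * (RInt G 1 2 - (2 - 1) * r))).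
  { apply (@is_RInt_scal R_NormedModule), (@is_RInt_minus R_NormedModule); [exact IG|].
    apply (@is_RInt_const R_NormedModule). }
  assert (Ch : forall x, 0 < x -> continuous h x)
    by (intros; apply kern_abs_pow_cont; [lra|assumption]).
  assert (Eh : ex_RInt h (/ d * 1 + 0) (/ d * 2 + 0)) by (apply ex_RInt_pos; auto; lra).
  assert (I2 : is_RInt (fun y => / d * h (/ d * y + 0)) 1 2 (RInt h (/ d * 1 + 0) (/ d * 2 + 0))).
  { apply (@is_RInt_comp_lin R_NormedModule h (/ d) 0 1 2).
    apply (@RInt_correct R_CompleteNormedModule), Eh. }
  assert (LE : A * (RInt G 1 2 - (2 - 1) * r) <= RInt h (/ d * 1 + 0) (/ d * 2 + 0)).
  { refine (is_RInt_le _ _ 1 2 _ _ _ I1 I2 _); [lra|]. intros y Hy. apply HG. lra. }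
  assert (GE := Lalpha_pow_ge alpha H ((1, t) :: l) K (/ d * 1 + 0) (/ d * 2 + 0)
     ltac:(lra) ltac:(lra) HK). fold h in GE.
  eapply Rle_trans; [|exact GE].
  rewrite Rmult_assoc. apply Rmult_le_compat_l; [lra|].
  eapply Rle_trans; [|exact LE].
  replace (k * Rpower r alpha * X) with (A * r).
  - apply Rmult_le_compat_l; [lra|]. assert (c0 = 2 * r) by (unfold r; field). lra.
  - unfold A. replace (Rpower r alpha) with (Rpower r (alpha - 1 + 1)) by (f_equal; ring).
    rewrite Rpower_plus, Rpower_1 by assumption. ring.
Qed.

(** * Local nondeterminism *)

Lemma kern_abs_pow_swap alpha H s t :
  kern_abs_pow alpha H ((1, t) :: (-1, s) :: nil) =
  kern_abs_pow alpha H ((1, s) :: (-1, t) :: nil).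
Proof.
  apply functional_extensionality. intros x. unfold kern_abs_pow. do 2 f_equal.
  cbn [kern_re kern_im fold_right fst snd]. unfold Rdiv. ring.
Qed.

Theorem mainTheorem8 :
  forall (alpha : R) (H : R -> R),
    1 < alpha < 2 -> hurst_hyp H ->
    forall eps T : R, 0 < eps < T ->
      (* (L1) *)
      (forall t, eps <= t <= T -> 0 < snorm alpha H ((1, t) :: nil)) /\
      (* (L2) *)
      (exists delta, 0 < delta /\
         forall s t, eps <= s <= T -> eps <= t <= T -> s <> t -> Rabs (t - s) < delta ->
           0 < snorm alpha H ((1, t) :: (-1, s) :: nil)) /\
      (* (L3) *)
      (forall n : nat, (1 < n)%nat ->
         exists Cn dn, 0 < Cn /\ 0 < dn /\
           forall tt : nat -> R,
             eps <= tt 0%nat ->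
             (forall i, (i + 1 < n)%nat -> tt i < tt (i + 1)%nat) ->
             tt (n - 1)%nat <= T ->
             tt (n - 1)%nat - tt 0%nat < dn ->
             forall u : nat -> R,
               snorm alpha H (pred_comb n tt u) >=
               Cn * snorm alpha H ((1, tt (n - 1)%nat) :: (-1, tt (n - 2)%nat) :: nil)).
Proof.
  intros alpha H Ha (hlo & hhi & H0 & H1 & HH & C & gamma & HC & Hg & Hol) eps T HT.
  assert (Hpos : forall l c d e, 0 < c -> c * Rpower d e <= Lalpha_pow alpha H l ->
    0 < snorm alpha H l).
  { intros l c d e Hc Hle. assert (G := Rpower_gt0 d e). unfold snorm.
    rewrite rpow_pos by nra. apply Rpower_gt0. }
  split; [|split].
  - intros t Ht.
    destruct (kern_lower alpha H hlo hhi 0 ltac:(lra) H0 H1 HH) as (c & Hc & Hlow).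
    (* With no other points the gap may be taken as d = t. *)
    apply (Hpos _ c t (alpha * H t) Hc). apply Hlow; [reflexivity|lra|].
    intros p [].
  - exists 1. split; [lra|]. intros s t Hs Ht Hst _.
    destruct (kern_lower alpha H hlo hhi 1 ltac:(lra) H0 H1 HH) as (c & Hc & Hlow).
    assert (P : forall s t, eps <= s -> s < t ->
      0 < snorm alpha H ((1, t) :: (-1, s) :: nil)).
    { intros a b Ha' Hab. apply (Hpos _ c (b - a) (alpha * H b) Hc).
      apply Hlow; [reflexivity|lra|]. intros p [<-|[]]. cbn [snd]. lra. }
    destruct (Rtotal_order s t) as [Hlt|[Heq|Hlt]]; [apply P; lra|contradiction|].
    (* For t < s the kernel only changes sign, so the norm is symmetric in s and t. *)
    unfold snorm, Lalpha_pow. rewrite kern_abs_pow_swap. apply (P t s); lra.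
  - intros n Hn.
    destruct (kern_lower alpha H hlo hhi (n - 1) ltac:(lra) H0 H1 HH) as (c & Hc & Hlow).
    destruct (increment_upper alpha H hlo hhi C gamma T ltac:(lra) H0 H1 HH HC Hg Hol ltac:(lra))
      as (K & HK & Hup).
    (* The ratio of the lower to the upper constant, both in front of d^(alpha H(t_n)); the value 1
       of [dn] gives the d <= 1 required by [increment_upper]. *)
    exists (Rpower (c / K) (/ alpha)), 1.
    split; [apply Rpower_gt0|]. split; [lra|].
    intros tt Htt0 Hinc HttT Hdn u.
    assert (Hmono : forall j i, (i + j < n)%nat -> tt i <= tt (i + j)%nat).
    { induction j as [|j IH]; intros i Hij; [rewrite Nat.add_0_r; lra|].
      specialize (IH i ltac:(lia)). specialize (Hinc (i + j)%nat ltac:(lia)).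
      replace (i + S j)%nat with (i + j + 1)%nat by lia. lra. }
    assert (Hle : forall i j, (i <= j)%nat -> (j < n)%nat -> tt i <= tt j).
    { intros i j Hij Hj. replace j with (i + (j - i))%nat by lia. apply Hmono. lia. }
    assert (Hlast : tt (n - 2)%nat < tt (n - 1)%nat).
    { replace (n - 1)%nat with (n - 2 + 1)%nat by lia. apply Hinc. lia. }
    assert (Hb : eps <= tt (n - 2)%nat).
    { apply Rle_trans with (tt 0%nat); [assumption|]. apply Hle; lia. }
    assert (Hd1 : tt (n - 1)%nat - tt (n - 2)%nat <= 1).
    { specialize (Hle 0%nat (n - 2)%nat ltac:(lia) ltac:(lia)). lra. }
    set (t := tt (n - 1)%nat) in *. set (s := tt (n - 2)%nat) in *.
    set (X := Rpower (t - s) (alpha * H t)). assert (GX : 0 < X) by apply Rpower_gt0.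
    (* All n - 1 predecessors lie at or below t_{n-1} = t - d, so the gap is d whatever the weights
       [u] are. *)
    assert (L : c * X <= Lalpha_pow alpha H (pred_comb n tt u)).
    { apply (Hlow (t - s) t (map (fun k => (- u k, tt k)) (seq 0 (n - 1))));
        [now rewrite length_map, length_seq|lra|].
      intros p Hp. apply in_map_iff in Hp. destruct Hp as (k & <- & Hk).
      apply in_seq in Hk. cbn [snd].
      assert (A1 := Hle 0%nat k ltac:(lia) ltac:(lia)).
      assert (A2 := Hle k (n - 2)%nat ltac:(lia) ltac:(lia)). fold s in A2. lra. }
    assert (U : Lalpha_pow alpha H ((1, t) :: (-1, s) :: nil) <= K * X)
      by (apply Hup; lra).
    assert (Hai : 0 <= / alpha) by (left; apply Rinv_0_lt_compat; lra).
    apply Rle_ge. unfold snorm.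
    apply Rle_trans with (Rpower (c / K) (/ alpha) * rpow (K * X) (/ alpha)).
    + apply Rmult_le_compat_l; [left; apply Rpower_gt0|]. now apply rpow_le.
    + rewrite <- rpow_mult.
      * apply rpow_le; [assumption|]. replace (c / K * (K * X)) with (c * X) by (field; lra).
        assumption.
      * now apply Rdiv_lt_0_compat.
      * nra.
Qed.
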